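(* Let $k$ be a field of positive characteristic $p$ and set $R=k[t_1,\dots,t_r]/(t_1^p,\dots,t_r^p)$. Let $K$ be an algebraically closed field extension of $k$ of transcendence degree at least $r-1$ over $k$. Then an $R$-module $M$ is projective if and only if for every flat homomorphism of $K$-algebras $\alpha\colon K[t]/(t^p)\to R_K$ the $K[t]/(t^p)$-module $\alpha^*(M^K)$ is projective.
   Context: $R_K=K\otimes_k R$, $M^K=\operatorname{Hom}_k(K,M)$ regarded as an $R_K$-module, and $\alpha^*$ denotes restriction of scalars along $\alpha$; flat means $R_K$ is flat as a $K[t]/(t^p)$-module via $\alpha$. *)

(* Defs.v *)
From HB Require Import structures.
From mathcomp Require Import all_boot all_algebra.
From mathcomp Require Import boolp.
From mathcomp Require Import mpoly.



Unset Printing Implicit Defensive.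

Import GRing.Theory.
Local Open Scope ring_scope.

(* Modules over  F[t_1,...,t_r]/(t_1^p,...,t_r^p).                          *)
(* Such a module is an F-vector space together with r F-linear operators    *)
(* (the actions of t_1,...,t_r) which commute pairwise and satisfy          *)
(* t_i^p = 0  (tmod_ax).  For r = 1 these are the modules over F[t]/(t^p).  *)

Record tmod (F : fieldType) (r : nat) := TMod {
  tcar :> lmodType F;
  top : 'I_r -> {linear tcar -> tcar} }.
Arguments top {F r} t i.

Definition tmod_ax (F : fieldType) (r p : nat) (M : tmod F r) : Prop :=
  (forall (i j : 'I_r) (x : M), top M i (top M j x) = top M j (top M i x)) /\
  (forall (i : 'I_r) (x : M), iter p (top M i) x = 0).
Arguments tmod_ax {F r} p M.

Definition tmorph (F : fieldType) (r : nat) (M N : tmod F r) (f : M -> N) : Prop :=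
  forall (i : 'I_r) (x : M), f (top M i x) = top N i (f x).
Arguments tmorph {F r M N} f.

Definition projective (F : fieldType) (r p : nat) (M : tmod F r) : Prop :=
  forall N N' : tmod F r, tmod_ax p N -> tmod_ax p N' ->
  forall g : {linear N -> N'}, tmorph g -> (forall y : N', exists x : N, g x = y) ->
  forall f : {linear M -> N'}, tmorph f ->
  exists h : {linear M -> N}, tmorph h /\ (forall x : M, g (h x) = f x).
Arguments projective {F r} p M.

(* The algebra  R_K = K[t_1..t_r]/(t_i^p), in its monomial basis            *)
(* t^m, m : 'I_r -> 'I_p.                                                   *)

Definition mon (r p : nat) := {ffun 'I_r -> 'I_p}.

Definition RKel (K : fieldType) (r p : nat) := mon r p -> K.

Definition mulRK (K : fieldType) (r p : nat) (a b : RKel K r p) : RKel K r p :=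
  fun m => \sum_(m1 : mon r p) \sum_(m2 : mon r p | [forall i, (m1 i + m2 i)%N == m i :> nat])
             a m1 * b m2.
Arguments mulRK {K r p} a b m.

Definition oneRK (K : fieldType) (r p : nat) : RKel K r p :=
  fun m => ([forall i, m i == 0 :> nat])%:R.

Definition deltaRK (K : fieldType) (r p : nat) (m0 : mon r p) : RKel K r p :=
  fun m => (m == m0)%:R.

Definition powRK (K : fieldType) (r p : nat) (a : RKel K r p) (n : nat) : RKel K r p :=
  iter n (mulRK a) (@oneRK K r p).

Definition monact (K : fieldType) (r p : nat) (M : tmod K r) (m : mon r p) : M -> M :=
  foldr (fun i f => iter (m i) (top M i) \o f) id (enum 'I_r).
Arguments monact {K r p M} m _.

Definition act (K : fieldType) (r p : nat) (M : tmod K r) (u : RKel K r p) (x : M) : M :=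
  \sum_(m : mon r p) u m *: @monact K r p M m x.
Arguments act {K r p} M u x.

Lemma iter_linear (K : fieldType) (V : lmodType K) (f : {linear V -> V}) n :
  linear (iter n f).
Proof.
elim: n => [|n IH] a x y //=.
by rewrite IH linearP.
Qed.

Lemma monact_linear (K : fieldType) (r p : nat) (M : tmod K r) (m : mon r p) :
  linear (@monact K r p M m).
Proof.
rewrite /monact; elim: (enum 'I_r) => [|i s IH] a x y //=.
by rewrite IH iter_linear.
Qed.

Lemma act_linear (K : fieldType) (r p : nat) (M : tmod K r) (u : RKel K r p) :
  linear (act M u).
Proof.
move=> a x y; rewrite /act scaler_sumr -big_split /=; apply: eq_bigr => m _.
by rewrite monact_linear scalerDr !scalerA mulrC.
Qed.

HB.instance Definition _ (K : fieldType) (r p : nat) (M : tmod K r) (u : RKel K r p) :=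
  GRing.isLinear.Build K M M *:%R (act M u) (@act_linear K r p M u).

(* restriction of scalars alpha^* along the K-algebra map
   alpha : K[t]/(t^p) -> R_K determined by alpha(t) = u *)
Definition restrict (K : fieldType) (r p : nat) (M : tmod K r) (u : RKel K r p) : tmod K 1 :=
  @TMod K 1 M (fun _ => (act M u : {linear M -> M})).
Arguments restrict {K r p} M u.

(* Flatness.  For an A-module N (A = K[t]/(t^p)) which is free of finite    *)
(* rank over K with K-basis indexed by I, on which t acts by the matrix S   *)
(* (t e_i = \sum_j S i j e_j), and an A-module L, we use the standard       *)
(* presentation  N (x)_A L = coker( t(x)1 - 1(x)t : N(x)_K L -> N(x)_K L ), *)
(* with N (x)_K L = L^I (sum_i e_i (x) y_i  <->  y).  N is flat iff         *)
(* N (x)_A - preserves injective maps.                                      *)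

Definition tD (K : fieldType) (I : finType) (S : I -> I -> K) (L : tmod K 1)
    (y : I -> L) (j : I) : L :=
  \sum_(i : I) S i j *: y i - top L ord0 (y j).
Arguments tD {K I} S {L} y j.

Definition tensor_flat (K : fieldType) (p : nat) (I : finType) (S : I -> I -> K) : Prop :=
  forall L1 L2 : tmod K 1, tmod_ax p L1 -> tmod_ax p L2 ->
  forall g : {linear L1 -> L2}, tmorph g -> injective g ->
  forall x : I -> L1,
    (exists y : I -> L2, forall j, g (x j) = tD S y j) ->
    exists z : I -> L1, forall j, x j = tD S z j.
Arguments tensor_flat {K} p {I} S.

(* alpha : K[t]/(t^p) -> R_K, alpha(t) = u, is flat: R_K (with t acting by
   multiplication by u) is a flat K[t]/(t^p)-module *)
Definition flat_alpha (K : fieldType) (r p : nat) (u : RKel K r p) : Prop :=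
  tensor_flat p (fun m m' : mon r p => mulRK u (@deltaRK K r p m) m').
Arguments flat_alpha {K r p} u.

Section MK.
Variables (k K : fieldType) (iota : {rmorphism k -> K}).

Definition Kk : Type := K.
HB.instance Definition _ := GRing.Zmodule.on Kk.

Definition Kk_scale (a : k) (x : Kk) : Kk := iota a * x.

Lemma Kk_scaleA a b (x : Kk) : Kk_scale a (Kk_scale b x) = Kk_scale (a * b) x.
Proof. by rewrite /Kk_scale rmorphM mulrA. Qed.
Lemma Kk_scale1 (x : Kk) : Kk_scale 1 x = x.
Proof. by rewrite /Kk_scale rmorph1 mul1r. Qed.
Lemma Kk_scaleDr a : {morph Kk_scale a : x y / x + y}.
Proof. by move=> x y; rewrite /Kk_scale mulrDr. Qed.
Lemma Kk_scaleDl (x : Kk) : {morph Kk_scale^~ x : a b / a + b}.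
Proof. by move=> a b; rewrite /Kk_scale rmorphD mulrDl. Qed.

HB.instance Definition _ := GRing.Zmodule_isLmodule.Build k Kk
  Kk_scaleA Kk_scale1 Kk_scaleDr Kk_scaleDl.

Variable (V : lmodType k).

Definition klin (f : Kk -> V) : bool := `[< linear f >].

Definition MKt := {f : Kk -> V | klin f}.
HB.instance Definition _ := [Choice of MKt by <:].

Lemma klinP (f : Kk -> V) : klin f -> linear f.
Proof. by move/asboolP. Qed.

Lemma klin_add (f : Kk -> V) : linear f -> forall x y, f (x + y) = f x + f y.
Proof. by move=> Lf x y; rewrite -[x in LHS]scale1r Lf scale1r. Qed.

Lemma klin0 : klin (fun _ => 0).
Proof. by apply/asboolP => a x y; rewrite scaler0 addr0. Qed.
Lemma klinN (f : MKt) : klin (fun x => - val f x).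
Proof.
apply/asboolP => a x y; rewrite (klinP _ (valP f)) opprD scalerN //.
Qed.
Lemma klinD (f g : MKt) : klin (fun x => val f x + val g x).
Proof.
apply/asboolP => a x y; rewrite (klinP _ (valP f)) (klinP _ (valP g)).
by rewrite scalerDr addrACA.
Qed.

Definition MK0 : MKt := exist (fun f => klin f) _ klin0.
Definition MKopp (f : MKt) : MKt := exist (fun f => klin f) _ (klinN f).
Definition MKadd (f g : MKt) : MKt := exist (fun f => klin f) _ (klinD f g).

Lemma MKaddA : associative MKadd.
Proof. by move=> f g h; apply: val_inj; apply: funext => x /=; rewrite addrA. Qed.
Lemma MKaddC : commutative MKadd.
Proof. by move=> f g; apply: val_inj; apply: funext => x /=; rewrite addrC. Qed.
Lemma MKadd0 : left_id MK0 MKadd.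
Proof. by move=> f; apply: val_inj; apply: funext => x /=; rewrite add0r. Qed.
Lemma MKaddN : left_inverse MK0 MKopp MKadd.
Proof. by move=> f; apply: val_inj; apply: funext => x /=; rewrite addNr. Qed.

HB.instance Definition _ := GRing.isZmodule.Build MKt MKaddA MKaddC MKadd0 MKaddN.

Lemma klinZ (c : K) (f : MKt) : klin (fun x : Kk => val f ((x : K) * c : Kk)).
Proof.
apply/asboolP => a x y.
have -> : ((a *: x + y : Kk) : K) * c = (a *: ((x : K) * c : Kk) + ((y : K) * c : Kk) : Kk).
  by rewrite /GRing.scale /= /Kk_scale mulrDl mulrA.
by rewrite (klinP _ (valP f)).
Qed.

Definition MKscale (c : K) (f : MKt) : MKt := exist (fun f => klin f) _ (klinZ c f).

Lemma MKscaleA a b (f : MKt) : MKscale a (MKscale b f) = MKscale (a * b) f.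
Proof. by apply: val_inj; apply: funext => x /=; rewrite mulrA. Qed.
Lemma MKscale1 (f : MKt) : MKscale 1 f = f.
Proof. by apply: val_inj; apply: funext => x /=; rewrite mulr1. Qed.
Lemma MKscaleDr a : {morph MKscale a : f g / f + g}.
Proof. by move=> f g; apply: val_inj; apply: funext => x. Qed.
Lemma MKscaleDl (f : MKt) : {morph MKscale^~ f : a b / a + b}.
Proof.
move=> a b; apply: val_inj; apply: funext => x /=.
by rewrite mulrDr (klin_add _ (klinP _ (valP f))).
Qed.

HB.instance Definition _ := GRing.Zmodule_isLmodule.Build K MKt
  MKscaleA MKscale1 MKscaleDr MKscaleDl.

Lemma klinT (T : {linear V -> V}) (f : MKt) : klin (T \o val f).
Proof. by apply/asboolP => a x y /=; rewrite (klinP _ (valP f)) linearP. Qed.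

Definition MKop (T : {linear V -> V}) (f : MKt) : MKt := exist (fun f => klin f) _ (klinT T f).

Lemma MKop_linear (T : {linear V -> V}) : linear (MKop T).
Proof. by move=> a f g; apply: val_inj; apply: funext => x /=; rewrite raddfD. Qed.

HB.instance Definition _ (T : {linear V -> V}) :=
  GRing.isLinear.Build K MKt MKt *:%R (MKop T) (MKop_linear T).

End MK.

Definition MK (k K : fieldType) (iota : {rmorphism k -> K}) (r : nat) (M : tmod k r)
  : tmod K r :=
  @TMod K r (MKt k K iota M) (fun i => (MKop k K iota M (top M i) : {linear _ -> _})).
Arguments MK {k K} iota {r} M.

Definition alg_indep (k K : fieldType) (iota : {rmorphism k -> K}) (n : nat)
    (x : 'I_n -> K) : Prop :=
  forall P : {mpoly k[n]}, P != 0 -> (map_mpoly iota P).@[x] != 0.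
Arguments alg_indep {k K} iota {n} x.

Definition trdeg_ge (k K : fieldType) (iota : {rmorphism k -> K}) (n : nat) : Prop :=
  exists x : 'I_n -> K, alg_indep iota x.
Arguments trdeg_ge {k K} iota n.

(* Main.v *)
Require Import Defs.
From HB Require Import structures.
From mathcomp Require Import all_boot all_algebra.
From mathcomp Require Import ssrAC.
From mathcomp Require Import boolp.
From mathcomp Require classical_sets.
From mathcomp Require Import mpoly.
From mathcomp Require Import ring.
Set Implicit Arguments.
Unset Strict Implicit.
Unset Printing Implicit Defensive.
Import GRing.Theory.
Local Open Scope ring_scope.

(** Write [sigma = prod_i t_i^(p-1)]. A module [M] is projective iff its socle is [sigma M]
    (Higman's criterion, using that a linear section of [sigma] exists), and [alpha] is flat
    iff [R_K] satisfies this criterion over [K[t]/(t^p)]. This gives the direct implication.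

    Conversely one enlarges [k] to be algebraically closed in [K] and argues by induction on
    [r], following Dade, Kroll and Benson-Carlson-Rickard. For [lam] in an extension [L] of
    [k] the hyperplane subalgebra generated by [a - lam b, t_3, ..., t_r], with [a = t_1] and
    [b = t_2], has rank [r - 1], so by induction [Hom_k(L, M)] is projective over it. On the
    vector space [H = soc M / sigma M] (a Tate cohomology group) the quotient of the Bockstein
    classes of [b] and [a] induces an operator [f], and replacing [a] by [a - lam b] changes
    [f] into [f - lam^p]. Projectivity over the hyperplanes with [lam] in [k] makes every
    [f - lam^p] bijective on [H], hence [H] a vector space over [k(X)] with [X] acting as [f].
    For [lam] in [L] transcendental over [k], [f - lam^p] is injective on [Hom_k(L, H)]; but
    a nonzero [k(lam^p)]-linear map [L -> H] is in its kernel unless [H = 0]. *)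

(** * Complements and linear sections *)

(** [H] may be infinite-dimensional, so [f] need not have an eigenvalue: hyperplanes with [lam] in
    [k] alone cannot force [H = 0], and only a generic [lam] excludes a [k(X)]-vector space.
    Algebraic closedness serves twice: every scalar is some [lam^p], so the operators [f - lam^p]
    are all the [f - c]; and polynomials split, so their bijectivity already makes every nonzero
    [P(f)] bijective. The extension carrying the generic [lam] must not exhaust [K], because the
    induction still needs room above it. It therefore climbs a chain of algebraically closed fields
    inside [K], spending one transcendental element for each variable after the first; this is the
    bound [r - 1]. The hypothesis on [M] climbs along, since [Hom_L'(K, Hom_L(L', M))] is
    [Hom_L(K, M)]. The quotient [H] is never formed: it is represented by a complement of [sigma M]
    in [soc M], and operators on it are made linear by choosing linear sections. *)

Lemma linear_bundle (F : fieldType) (U V : lmodType F) (f : U -> V) :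
  linear f -> exists g : {linear U -> V}, g =1 f.
Proof.
move=> Lf.
pose g := HB.pack_for {linear U -> V} f (GRing.isLinear.Build F U V *:%R f Lf).
by exists g.
Qed.

Section Subspaces.
Variable F : fieldType.
Implicit Types U V : lmodType F.

Definition subspace V (P : V -> Prop) :=
  P 0 /\ forall a x y, P x -> P y -> P (a *: x + y).

Lemma subspaceD V (P : V -> Prop) x y : subspace P -> P x -> P y -> P (x + y).
Proof. by move=> [_ H] Px Py; rewrite -[x]scale1r; exact: H. Qed.

Lemma subspaceZ V (P : V -> Prop) a x : subspace P -> P x -> P (a *: x).
Proof. by move=> [P0 H] Px; rewrite -[_ *: _]addr0; exact: H. Qed.

Lemma subspaceB V (P : V -> Prop) x y : subspace P -> P x -> P y -> P (x - y).
Proof. by move=> [_ H] Px Py; rewrite addrC -scaleN1r; exact: H. Qed.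

Lemma subspaceT V : subspace (fun _ : V => True).
Proof. by []. Qed.

Lemma complement V (Q : V -> Prop) : subspace Q ->
  exists W : V -> Prop, [/\ subspace W, forall x, W x -> Q x -> x = 0 &
    forall x, exists q w, [/\ Q q, W w & x = q + w]].
Proof.
move=> [Q0 Qlin].
(* Membership of 0 is not part of [P], so that the union of the empty chain qualifies for Zorn;
   maximality puts 0 back afterwards. *)
pose P (A : V -> Prop) := (forall a x y, A x -> A y -> A (a *: x + y)) /\
  (forall x, A x -> Q x -> x = 0).
have [] := @classical_sets.Zorn_bigcup V P.
  move=> C CP Ctot; split.
    move=> a x y [A CA Ax] [B CB By].
    have [AB|BA] := Ctot A B CA CB.
      by exists B => //; apply: (proj1 (CP _ CB)) => //; exact: AB.
    by exists A => //; apply: (proj1 (CP _ CA)) => //; exact: BA.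
  by move=> x [A CA Ax]; exact: (proj2 (CP _ CA)).
move=> W [[Wlin WQ] Wmax].
have extend B : P B -> (forall x, W x -> B x) -> forall x, B x -> W x.
  move=> PB WB x Bx; apply: contrapT => nWx; apply: (Wmax B) => //.
  by split=> // BW; apply: nWx; exact: BW.
have W0 : W 0.
  apply: (extend (fun x => x = 0 \/ W x)); last by left.
    split; last by move=> x [|Wx Qx] //; exact: WQ.
    move=> a x y [->|Wx] [->|Wy]; rewrite ?scaler0 ?add0r; try by [left|right].
      by right; have := Wlin (a - 1) x x Wx Wx; rewrite scalerBl scale1r addrNK addr0.
    by right; exact: Wlin.
  by move=> x; right.
exists W; split=> // x.
have [Wx|nWx] := pselect (W x); first by exists 0, x; rewrite add0r.
pose B y := exists a w, W w /\ y = a *: x + w.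
have [b [w [Ww [Qb nb]]]] : exists b w, W w /\ (Q (b *: x + w) /\ b *: x + w <> 0).
  apply: contrapT => H; apply: nWx; apply: (extend B).
  - split; last first.
      move=> y [b [w [Ww ->]]] Qy; apply: contrapT => ny; apply: H.
      by exists b, w.
    move=> a y z [b [w [Ww ->]]] [c [v [Wv ->]]]; exists (a * b + c), (a *: w + v).
    by split; [exact: Wlin | rewrite scalerDr addrACA scalerA scalerDl].
  - by move=> y Wy; exists 0, y; rewrite scale0r add0r.
  - by exists 1, 0; rewrite scale1r addr0.
have b0 : b != 0.
  by apply/eqP => b0; apply: nb; apply: WQ => //; rewrite b0 scale0r add0r.
exists (b^-1 *: (b *: x + w)), (- b^-1 *: w); split.
- by rewrite -[_ *: _]addr0; exact: Qlin.
- by rewrite -[_ *: _]addr0; exact: Wlin.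
- by rewrite scaleNr -scalerBr addrK scalerA mulVf // scale1r.
Qed.

(** [S v] is the unique [u] in [N], lying in a complement of the kernel of [T] on [N], such that
    [v - T u] lies in a complement of [T(N)]; uniqueness gives linearity. Keeping [N] a predicate
    yields sections with values in a socle without a subtype. *)
Lemma linear_section U V (T : {linear U -> V}) (N : U -> Prop) : subspace N ->
  exists S : {linear V -> U}, (forall v, N (S v)) /\ forall u, N u -> T (S (T u)) = T u.
Proof.
move=> sN; have [N0 Nlin] := sN.
have [|W1 [[W10 W1lin] W1K W1D]] := @complement U (fun u => N u /\ T u = 0).
  by split=> [|a x y [Nx Tx] [Ny Ty]]; rewrite ?linear0 // linearP Tx Ty scaler0 addr0;
     split=> //; exact: Nlin.
have [|W [[W0 Wlin] WK WD]] := @complement V (fun v => exists2 u, N u & v = T u).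
  split=> [|a x y [u Nu ->] [v Nv ->]]; first by exists 0; rewrite ?linear0.
  by exists (a *: u + v); rewrite ?linearP //; exact: Nlin.
pose R v u := [/\ N u, W1 u & W (v - T u)].
have Rex v : exists u, R v u.
  have [_ [w [[u Nu ->] Ww vE]]] := WD v.
  have [n [u1 [[Nn Tn] W1u uE]]] := W1D u; exists u1; split=> //.
    by rewrite -[u1](addKr n) -uE addrC; exact: subspaceB.
  by rewrite vE uE linearD Tn add0r addrC addKr.
have Runi v u u' : R v u -> R v u' -> u = u'.
  move=> [Nu W1u Wu] [Nu' W1u' Wu']; apply/eqP; rewrite -subr_eq0; apply/eqP.
  apply: W1K; first by apply: subspaceB.
  split; first exact: subspaceB.
  apply: WK; last by exists (u - u') => //; exact: subspaceB.
  have -> : T (u - u') = (v - T u') - (v - T u).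
    by rewrite linearB opprB [RHS]addrC addrA addrNK.
  exact: subspaceB.
have [f Rf] := choice Rex.
have Lf : linear f.
  move=> a x y; apply: (Runi (a *: x + y)) => //.
  have [N1 A1 B1] := Rf x; have [N2 A2 B2] := Rf y.
  split; [exact: Nlin|exact: W1lin|].
  by rewrite linearP opprD addrACA -scalerBr; exact: Wlin.
have [S SE] := linear_bundle Lf; exists S; split=> [v|u Nu]; rewrite SE.
  by have [] := Rf v.
have [Nf _ Wf] := Rf (T u); apply/esym/eqP; rewrite -subr_eq0; apply/eqP.
by apply: WK => //; exists (u - f (T u)); rewrite ?linearB //; exact: subspaceB.
Qed.

Lemma linear_functional V (v : V) : v != 0 ->
  exists f : {linear V -> F^o}, f v = 1.
Proof.
move=> v0; have L : linear (fun c : F^o => c *: v).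
  by move=> a b c; rewrite scalerDl scalerA.
have [T TE] := linear_bundle L.
have [S [_ H]] := linear_section T (@subspaceT _).
exists S; have := H 1 I; rewrite !TE scale1r => /eqP.
rewrite -subr_eq0 -{3}[v]scale1r -scalerBl scaler_eq0 (negbTE v0) orbF subr_eq0.
by move/eqP.
Qed.
End Subspaces.

(** * Socle criterion and traces *)

Section Iter.
Variables (F : fieldType) (V : lmodType F).
Implicit Types f g : {linear V -> V}.

Lemma iter_lin0 f n : iter n f 0 = 0.
Proof. by elim: n => //= n ->; rewrite linear0. Qed.

Lemma iter_linZ f n a x : iter n f (a *: x) = a *: iter n f x.
Proof. by have := iter_linear F V f n a x 0; rewrite !addr0 iter_lin0 addr0. Qed.

Lemma iter_linD f n x y : iter n f (x + y) = iter n f x + iter n f y.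
Proof. by have := iter_linear F V f n 1 x y; rewrite !scale1r. Qed.

Lemma iter_linB f n x y : iter n f (x - y) = iter n f x - iter n f y.
Proof. by rewrite iter_linD -[in LHS]scaleN1r iter_linZ scaleN1r. Qed.

Lemma iter_comm f g n x : (forall y, f (g y) = g (f y)) ->
  f (iter n g x) = iter n g (f x).
Proof. by move=> fg; elim: n => //= n IH; rewrite fg IH. Qed.

Lemma iter_comm2 f g m n x : (forall y, f (g y) = g (f y)) ->
  iter m f (iter n g x) = iter n g (iter m f x).
Proof. by move=> fg; elim: m => //= m ->; rewrite iter_comm. Qed.

Lemma iter_ge f p n x : (forall y, iter p f y = 0) -> (p <= n)%N -> iter n f x = 0.
Proof. by move=> fp /subnK <-; rewrite iterD fp iter_lin0. Qed.
End Iter.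

Section Socle.
Variables (F : fieldType) (r p : nat).
Implicit Types M N : tmod F r.

Definition sigs M (s : seq 'I_r) : M -> M :=
  foldr (fun i f => iter p.-1 (top M i) \o f) id s.
Definition sig M : M -> M := sigs (enum 'I_r).

(** For [p > 0] the other inclusion holds by [sig_kill], so this says that the socle is the image of
    [sigma]; for [r = 1] it reads [ker t = im t^(p-1)]. *)
Definition exact M := forall x : M, (forall i, top M i x = 0) -> exists y, x = sig y.

Lemma sigs_linear M s : linear (@sigs M s).
Proof. by elim: s => [|i s IH] a x y //=; rewrite IH iter_linear. Qed.

Lemma sig_linear M : linear (@sig M).
Proof. exact: sigs_linear. Qed.

Lemma sigs_comm M (f : {linear M -> M}) s x :
  (forall i x, f (top M i x) = top M i (f x)) -> f (sigs s x) = sigs s (f x).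
Proof. by move=> fM; elim: s => //= i s IH; rewrite iter_comm ?IH. Qed.

Lemma sigs_kill M i s x : (0 < p)%N -> tmod_ax p M -> i \in s ->
  top M i (sigs s x) = 0.
Proof.
move=> p0 [cM nM]; elim: s => //= j s IH; rewrite in_cons => /orP[/eqP <-|/IH {}IH].
  by rewrite -iterS prednK // nM.
by rewrite iter_comm // IH iter_lin0.
Qed.

Lemma sig_kill M i x : (0 < p)%N -> tmod_ax p M -> top M i (sig x) = 0.
Proof. by move=> p0 aM; apply: sigs_kill => //; rewrite mem_enum. Qed.

(** The sum of the [t^j (x) t^(p-1-j)] is the Casimir element of the Frobenius algebra [F[t]/(t^p)];
    contracting a linear map with it gives a map that commutes with [t]. *)
Definition tr1 M N i (phi : M -> N) (x : M) : N :=
  \sum_(j < p) iter j (top N i) (phi (iter (p.-1 - j) (top M i) x)).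

Definition tr M N (phi : M -> N) (s : seq 'I_r) : M -> N := foldr (@tr1 M N) phi s.

Lemma tr1_linear M N i (phi : M -> N) : linear phi -> linear (tr1 i phi).
Proof.
move=> L a x y; rewrite /tr1 scaler_sumr -big_split; apply: eq_bigr => j _ /=.
by rewrite iter_linear L iter_linear.
Qed.

Lemma tr_linear M N (phi : M -> N) s : linear phi -> linear (tr phi s).
Proof. by move=> L; elim: s => //= i s IH; exact: tr1_linear. Qed.

Lemma linear_fun0 M N (phi : M -> N) : linear phi -> phi 0 = 0.
Proof. by move=> L; have := L (-1) 0 0; rewrite scaler0 addr0 scaleN1r addNr. Qed.

(** Both sides are the sum of [t^j phi t^(p-j)] over [0 < j < p]; the extreme terms contain
    [t^p]. *)
Lemma tr1_top M N i (phi : M -> N) x : tmod_ax p M -> tmod_ax p N -> linear phi ->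
  top N i (tr1 i phi x) = tr1 i phi (top M i x).
Proof.
rewrite /tr1; case: p => [|q] [_ nM] [_ nN] L; rewrite ?big_ord0 ?linear0 // linear_sum.
rewrite big_ord_recr [RHS]big_ord_recl /= subnn /= -iterS nN addr0.
rewrite subn0 -iterSr nM linear_fun0 // add0r; apply: eq_bigr => j _.
by rewrite -iterSr /bump /= add0n add1n -[top M i (iter _ _ _)]iterS subnSK.
Qed.

Lemma tr1_comm M N i i' (phi : M -> N) : tmod_ax p M -> tmod_ax p N ->
  (forall x, top N i' (phi x) = phi (top M i' x)) ->
  forall x, top N i' (tr1 i phi x) = tr1 i phi (top M i' x).
Proof.
move=> [cM _] [cN _] H x; rewrite /tr1 linear_sum; apply: eq_bigr => j _.
by rewrite iter_comm // H iter_comm.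
Qed.

Lemma tr_comm M N i (phi : M -> N) s : tmod_ax p M -> tmod_ax p N ->
  linear phi -> i \in s -> forall x, top N i (tr phi s x) = tr phi s (top M i x).
Proof.
move=> aM aN L; elim: s => //= j s IH; rewrite in_cons => /orP[/eqP <-|/IH {}IH] x.
  by apply: tr1_top => //; exact: tr_linear.
exact: tr1_comm.
Qed.

Lemma tr_socle M N (phi : M -> N) s x : (0 < p)%N -> linear phi ->
  (forall i, top M i x = 0) -> tr phi s x = sigs s (phi x).
Proof.
move=> p0 L sx; elim: s => //= i s <-; rewrite /tr1.
have Lt := tr_linear s L; move: (tr phi s) Lt => psi Lt.
case: p p0 => //= q _; rewrite big_ord_recr /= subnn big1 ?add0r // => j _.
rewrite -[(q - j)%N]prednK ?subn_gt0 ?ltn_ord // iterSr sx iter_lin0.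
by rewrite linear_fun0 ?iter_lin0.
Qed.

Lemma tmorph_iter M N (g : M -> N) i n x : tmorph g ->
  g (iter n (top M i) x) = iter n (top N i) (g x).
Proof. by move=> gm; elim: n => //= n <-. Qed.

Lemma tr_compl M N N' (g : {linear N -> N'}) (phi : M -> N) s : tmorph g ->
  forall x, g (tr phi s x) = tr (g \o phi) s x.
Proof.
move=> gm; elim: s => //= i s IH x; rewrite /tr1 linear_sum.
by apply: eq_bigr => j _; rewrite -IH (tmorph_iter _ _ _ gm).
Qed.

Lemma tr_compr M N N' (g : {linear M -> N}) (phi : N -> N') s : tmorph g ->
  forall x, tr phi s (g x) = tr (phi \o g) s x.
Proof.
move=> gm; elim: s => //= i s IH x; rewrite /tr1.
by apply: eq_bigr => j _; rewrite -IH (tmorph_iter _ _ _ gm).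
Qed.

Lemma eq_tr M N (phi psi : M -> N) s : phi =1 psi -> tr phi s =1 tr psi s.
Proof. by move=> /funext ->. Qed.

(** The variables are released one at a time. If [E^n] kills what is annihilated by [t_d] and all
    later variables, then an induction on [j] shows that [E^(n j)] kills what is annihilated by
    [t_d^j] and the variables after [t_d]. Taking [j = p] gives an exponent independent of the
    vector. *)
Lemma nilpotent_of_socle M (E : {linear M -> M}) : (0 < p)%N -> tmod_ax p M ->
  tmorph E -> (forall x, (forall i, top M i x = 0) -> E x = 0) ->
  exists n, forall x, iter n E x = 0.
Proof.
move=> p0 [cM nM] Em Es.
suff H d : exists n, forall x : M,
    (forall i : 'I_r, (d <= i)%N -> top M i x = 0) -> iter n E x = 0.
  by have [n Hn] := H r; exists n => x; apply: Hn => i; rewrite leqNgt ltn_ord.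
elim: d => [|d [n IH]]; first by exists 1 => x Hx; apply: Es => i; exact: Hx.
have [dr|rd] := ltnP d r; last first.
  by exists n => x _; apply: IH => i di; have := ltn_ord i; rewrite ltnNge (leq_trans rd).
pose i0 := Ordinal dr.
suff H j x : (forall i : 'I_r, (d < i)%N -> top M i x = 0) -> iter j (top M i0) x = 0 ->
    iter (n * j) E x = 0.
  by exists (n * p)%N => x Hx; apply: H => //; exact: nM.
elim: j x => [|j IHj] x Hx; first by rewrite muln0.
rewrite iterSr mulnS iterD => ijx; apply: IH => i.
rewrite leq_eqVlt => /orP[/eqP di|di].
  have -> : i = i0 by exact: val_inj.
  rewrite iter_comm; last by move=> y; rewrite Em.
  apply: IHj => // k dk; by rewrite cM Hx // linear0.
rewrite iter_comm; last by move=> y; rewrite Em.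
by rewrite Hx // iter_lin0.
Qed.

(* With [sm] a linear section of [sigma], [psi := Tr sm] is an endomorphism which is
   the identity on the socle, hence unipotent, and [psi^-1] is a geometric sum. *)
Lemma higman M : (0 < p)%N -> tmod_ax p M -> exact M ->
  exists phi : {linear M -> M}, forall x, tr phi (enum 'I_r) x = x.
Proof.
move=> p0 aM eM; have [sg sgE] := linear_bundle (@sig_linear M).
have [sm [_ smE]] := linear_section sg (@subspaceT _ M).
have [psi psiE] := linear_bundle (tr_linear (M:=M) (N:=M) (enum 'I_r) (linearP sm)).
have psim : tmorph psi.
  by move=> i x; rewrite !psiE tr_comm ?mem_enum //; exact: linearP.
have psis x : (forall i, top M i x = 0) -> psi x = x.
  move=> sx; rewrite psiE tr_socle //; last exact: linearP.
  have [y xy] := eM _ sx; rewrite -/(sig _) -sgE xy -sgE; exact: smE.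
have [E EE] := linear_bundle (linearP (idfun \- psi)).
have Em : tmorph E by move=> i x; rewrite !EE /= psim linearB.
have [|n En] := nilpotent_of_socle p0 aM Em.
  by move=> x sx; rewrite EE /= psis ?subrr.
suff H m : exists chi : {linear M -> M}, tmorph chi /\ forall x, psi (chi x) = x - iter m E x.
  have [chi [chim chiE]] := H n.
  exists (sm \o chi) => x.
  have -> : tr (sm \o chi) (enum 'I_r) x = tr sm (enum 'I_r) (chi x) by rewrite tr_compr.
  by rewrite -psiE chiE En subr0.
elim: m => [|m [chi [chim chiE]]].
  by exists \0; split=> [i x|x] /=; rewrite ?linear0 ?subrr.
exists (idfun \+ (E \o chi)); split=> [i x|x] /=; first by rewrite chim Em linearD.
have psiEE y : psi (E y) = E (psi y) by rewrite !EE /= linearB.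
by rewrite linearD /= psiEE chiE linearB addrA (EE x) /= [psi x + _]addrC subrK.
Qed.
End Socle.

(** * Free modules and the action of the coefficient algebra *)

Section Monomials.
Variables (F : fieldType) (r p : nat).
Implicit Types (M N : tmod F r) (e : 'I_r -> nat) (m : mon r p).

(** Exponents are unbounded here, so that monomials multiply by adding exponents; truncation enters
    through [monfold_ge]. *)
Definition monfold M e (s : seq 'I_r) : M -> M :=
  foldr (fun i f => iter (e i) (top M i) \o f) id s.

Lemma monfold_cons M e i s x :
  monfold e (i :: s) x = iter (e i) (top M i) (monfold e s x).
Proof. by []. Qed.

Lemma monactE M m x : monact m x = monfold (fun i => m i : nat) (enum 'I_r) x :> M.
Proof. by []. Qed.

Lemma eq_monfold M e e' s : {in s, e =1 e'} -> @monfold M e s =1 monfold e' s.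
Proof.
elim: s => // i s IH H x; rewrite !monfold_cons IH ?H ?mem_head // => j js.
by apply: H; rewrite in_cons js orbT.
Qed.

Lemma monfold_top M e s i x : tmod_ax p M -> uniq s -> i \in s ->
  top M i (monfold e s x) = monfold (fun l => (i == l) + e l)%N s x.
Proof.
move=> [cM nM]; elim: s => // j s IH /andP[js us].
rewrite in_cons !monfold_cons => /orP[/eqP ij|si].
  subst j; rewrite eqxx -iterS; congr (iter _ _ _); apply: eq_monfold => l ls.
  by rewrite /=; case: eqP => // E; rewrite -E (negbTE js) in ls.
have -> : (i == j) = false by apply: contraNF js => /eqP <-.
by rewrite iter_comm // IH.
Qed.

Lemma monfold_ge M e s i x : tmod_ax p M -> uniq s -> i \in s -> (p <= e i)%N ->
  monfold e s x = 0 :> M.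
Proof.
move=> [cM nM]; elim: s => // j s IH /andP[js us].
rewrite in_cons monfold_cons => /orP[/eqP <-|si] pe; first by apply: (iter_ge _ (nM i)).
by rewrite IH ?iter_lin0.
Qed.

Definition monS (i : 'I_r) m (j : mon r p) : bool :=
  [forall l, (m l + (i == l))%N == j l :> nat].

Lemma top_monact M i m x : tmod_ax p M ->
  top M i (monact m x) = \sum_(j | monS i m j) monact j x.
Proof.
move=> aM; rewrite monactE monfold_top ?enum_uniq ?mem_enum //.
have [mi|mi] := ltnP (m i).+1 p; last first.
  rewrite (monfold_ge _ aM (enum_uniq _) (mem_enum _ i)) ?eqxx //.
  rewrite big_pred0 // => j; apply: contraTF mi => /forallP /(_ i)/eqP.
  by rewrite eqxx addn1 -ltnNge => ->; exact: ltn_ord.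
have lt l : (m l + (i == l) < p)%N.
  by case: eqP => [<-|_]; rewrite ?addn1 // addn0 ltn_ord.
rewrite (big_pred1 [ffun l => Ordinal (lt l)]).
  by rewrite monactE; apply: eq_monfold => l _; rewrite ffunE /= addnC.
move=> j; apply/forallP/eqP => [H|-> l]; last by rewrite ffunE.
by apply/ffunP => l; apply: val_inj; rewrite ffunE /= (eqP (H l)).
Qed.

Lemma sig_monfold M x : sig p x = monfold (fun=> p.-1) (enum 'I_r) x :> M.
Proof. by []. Qed.

Lemma tmorph_monact M N (g : M -> N) m x : tmorph g ->
  g (monact m x) = monact m (g x).
Proof.
move=> gm; rewrite !monactE; elim: (enum _) => // i s IH.
by rewrite !monfold_cons tmorph_iter ?IH.
Qed.

Lemma tmorph_act M N (g : {linear M -> N}) (u : RKel F r p) x : tmorph g ->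
  g (act M u x) = act N u (g x).
Proof.
move=> gm; rewrite /act linear_sum; apply: eq_bigr => m _.
by rewrite linearZ /= tmorph_monact.
Qed.

End Monomials.

Section FreeModule.
Variables (F : fieldType) (r p : nat) (V : lmodType F).
Hypothesis p0 : (0 < p)%N.
Notation mon := (mon r p).

(** Multiplication by the monomial [t^e] on [R (x) V], in coordinates. *)
Definition shift (e : 'I_r -> nat) (n : {ffun mon -> V}) : {ffun mon -> V} :=
  [ffun j : mon => \sum_(m : mon | [forall l, (m l + e l)%N == j l :> nat]) n m].

Lemma shift_linear e : linear (shift e).
Proof.
move=> a x y; apply/ffunP => j; rewrite !ffunE scaler_sumr -big_split.
by apply: eq_bigr => m _; rewrite !ffunE.
Qed.

HB.instance Definition _ e := GRing.isLinear.Build F {ffun mon -> V} {ffun mon -> V} *:%R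
  (shift e) (shift_linear e).

Definition Free : tmod F r :=
  @TMod F r {ffun mon -> V} (fun i => shift (fun l => i == l)).

Lemma eq_shift e e' n : e =1 e' -> shift e n = shift e' n.
Proof.
move=> E; apply/ffunP => j; rewrite !ffunE; apply: eq_bigl => m.
by apply: eq_forallb => l; rewrite E.
Qed.

Lemma shift_add e e' n : shift e (shift e' n) = shift (fun l => e l + e' l)%N n.
Proof.
apply/ffunP => j; rewrite !ffunE.
under eq_bigr do rewrite ffunE.
rewrite (exchange_big_dep (fun m : mon => [forall l, (m l + (e l + e' l))%N == j l :> nat])) /=.
  apply: eq_bigr => m /forallP H.
  have lt l : (m l + e' l < p)%N.
    by have := ltn_ord (j l); rewrite -(eqP (H l)); apply: leq_ltn_trans; rewrite leq_add2l leq_addl.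
  rewrite (big_pred1 [ffun l => Ordinal (lt l)]) // => k.
  apply/andP/eqP => [[_ /forallP H']|->].
    by apply/ffunP => l; apply: val_inj; rewrite ffunE /= (eqP (H' l)).
  split; apply/forallP => l; rewrite ffunE //=.
  by rewrite -addnA [(e' l + _)%N]addnC.
move=> k m /forallP H /forallP H'; apply/forallP => l.
by rewrite -(eqP (H l)) -(eqP (H' l)) -addnA [(e' l + _)%N]addnC.
Qed.

Lemma shift0 n : shift (fun=> 0%N) n = n.
Proof.
apply/ffunP => j; rewrite ffunE (big_pred1 j) // => m.
apply/forallP/eqP => [H|-> l]; last by rewrite addn0.
by apply/ffunP => l; apply: val_inj; rewrite /= -(eqP (H l)) addn0.
Qed.

Lemma iter_shift e k n : iter k (shift e) n = shift (fun l => k * e l)%N n.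
Proof.
by elim: k => [|k IH]; rewrite ?shift0 //= IH shift_add.
Qed.

Lemma Free_ax : tmod_ax p Free.
Proof.
split=> [i j x|i x]; first by rewrite /= !shift_add; apply: eq_shift => l; rewrite addnC.
rewrite iter_shift; apply/ffunP => j; rewrite !ffunE big_pred0 // => m.
apply/negP => /forallP /(_ i); rewrite eqxx muln1 => /eqP E.
by have := ltn_ord (j i); rewrite -E ltnNge leq_addl.
Qed.

Lemma monfold_Free e n : monfold e (enum 'I_r) (n : Free) = shift e n :> Free.
Proof.
suff H s : uniq s -> monfold e s (n : Free) = shift (fun l => (l \in s) * e l)%N n.
  by rewrite H ?enum_uniq //; apply: eq_shift => l; rewrite mem_enum mul1n.
elim: s => [_|i s IH /andP[is_ us]]; first by rewrite /monfold /= shift0.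
rewrite monfold_cons IH // iter_shift shift_add; apply: eq_shift => l; rewrite in_cons.
rewrite [l == i]eq_sym; case: eqP => [<-|_]; last by rewrite muln0.
by rewrite (negbTE is_) muln1 mul1n addn0.
Qed.

Lemma act_FreeE (u : RKel F r p) (n : Free) j : (act Free u n : {ffun mon -> V}) j =
  \sum_(m1 : mon) \sum_(m2 : mon | [forall i, (m1 i + m2 i)%N == j i :> nat])
     u m1 *: (n : {ffun mon -> V}) m2.
Proof.
rewrite /act sum_ffunE; apply: eq_bigr => m _; rewrite ffunE monactE monfold_Free ffunE.
rewrite scaler_sumr; apply: eq_bigl => m2.
by apply: eq_forallb => l; rewrite addnC.
Qed.

Definition mon0 : mon := [ffun=> Ordinal p0].

Definition single (v : V) : {ffun mon -> V} := [ffun m => if m == mon0 then v else 0].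

Lemma Free_exact : exact p Free.
Proof.
move=> n Hn; have lt1 : (p.-1 < p)%N by rewrite prednK.
pose top_ : mon := [ffun=> Ordinal lt1].
exists (single ((n : {ffun mon -> V}) top_)); rewrite sig_monfold monfold_Free.
apply/ffunP => j; rewrite ffunE.
(* If [m i < p-1], the coefficient of [n] at [t^m] is that of [t_i n] at [t_i t^m], hence zero. *)
have z (m : mon) : m != top_ -> (n : {ffun mon -> V}) m = 0.
  move=> /eqP mt; have [i mi] : exists i, ((m i).+1 < p)%N.
    apply: contrapT => H; apply: mt; apply/ffunP => i; apply: val_inj.
    rewrite ffunE /=; apply/eqP; rewrite eqn_leq -ltnS prednK // ltn_ord /= -ltnS prednK //.
    by rewrite leqNgt; apply/negP => H'; apply: H; exists i.
  have lt l : (m l + (i == l) < p)%N.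
    by case: eqP => [<-|_]; rewrite ?addn1 // addn0 ltn_ord.
  have /ffunP/(_ [ffun l => Ordinal (lt l)]) := Hn i; rewrite !ffunE => <-.
  rewrite (big_pred1 m) // => k; apply/forallP/eqP => [H|-> l]; last by rewrite ffunE.
  apply/ffunP => l; apply: val_inj; have := H l; rewrite ffunE /= eqn_add2r.
  by move/eqP.
have [->|jt] := eqVneq j top_; last first.
  rewrite (z j jt) big1 // => m /forallP H; rewrite ffunE; case: eqP => // m0.
  case/eqP: jt; apply/ffunP => l; apply: val_inj.
  by rewrite /= -(eqP (H l)) m0 !ffunE.
rewrite (bigD1 mon0) /=; last by apply/forallP => l; rewrite !ffunE.
rewrite ffunE eqxx big1 ?addr0 // => m /andP[_ /negbTE mm0].
by rewrite ffunE mm0.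
Qed.
End FreeModule.

Section Evaluation.
Variables (F : fieldType) (r p : nat) (V : lmodType F) (M : tmod F r).
Hypothesis (p0 : (0 < p)%N) (aM : tmod_ax p M).

Lemma Free_lift (phi : {linear V -> M}) :
  exists ev : {linear Free r p V -> M}, tmorph ev /\
    forall n : Free r p V, ev n = \sum_m monact m (phi ((n : {ffun mon r p -> V}) m)).
Proof.
pose f (n : {ffun mon r p -> V}) := \sum_m monact m (phi (n m)) : M.
have Lf : linear f.
  move=> a x y; rewrite /f scaler_sumr -big_split; apply: eq_bigr => m _.
  by rewrite !ffunE linearP monact_linear.
have [ev evE] := linear_bundle Lf; exists ev; split=> [i n|n]; rewrite !evE // /f.
rewrite linear_sum /=.
under eq_bigr => m _ do rewrite ffunE linear_sum /= monactE.
under [RHS]eq_bigr => m _ do rewrite top_monact //.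
rewrite [RHS](exchange_big_dep predT) //=; apply: eq_bigr => j _.
have [g gE] := linear_bundle (monact_linear _ _ _ M j).
rewrite -monactE -gE linear_sum; apply: eq_bigr => m _; by rewrite gE.
Qed.

Lemma monact0 (x : M) : monact (mon0 r p0) x = x.
Proof.
rewrite monactE; elim: (enum _) => // i s IH.
by rewrite monfold_cons IH ffunE.
Qed.

Lemma Free_ev_single (phi : {linear V -> M}) v :
  \sum_m monact m (phi (single r p0 v m)) = phi v.
Proof.
rewrite (bigD1 (mon0 r p0)) //= ffunE eqxx monact0 big1 ?addr0 // => m /negbTE mm.
have [g gE] := linear_bundle (monact_linear _ _ _ M m).
by rewrite ffunE mm linear0 -gE linear0.
Qed.
End Evaluation.

Section Action.
Variables (K : fieldType) (r p : nat) (N : tmod K r).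
Hypotheses (p0 : (0 < p)%N) (aN : tmod_ax p N).

Definition FreeK := Free r p K^o.
Definition toFree (u : RKel K r p) : FreeK := [ffun m => u m : K^o].
Definition ofFree (n : FreeK) : RKel K r p := fun m => (n : {ffun mon r p -> K^o}) m.

Lemma eq_act (M : tmod K r) (u v : RKel K r p) : u =1 v -> act M u =1 act M v.
Proof. by move=> /funext ->. Qed.

(** Acting on [x] is a morphism from the free module of rank one, so identities checked in [R_K]
    hold in every module. *)
Lemma act_ev (x : N) : exists ev : {linear FreeK -> N}, tmorph ev /\
  forall n, ev n = act N (ofFree n) x.
Proof.
have L : linear (fun c : K^o => c *: x) by move=> a b c; rewrite scalerDl scalerA.
have [phi phiE] := linear_bundle L.
have [ev [evm evE]] := Free_lift aN phi; exists ev; split=> // n.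
rewrite evE; apply: eq_bigr => m _; rewrite phiE.
have [g gE] := linear_bundle (monact_linear _ _ _ N m).
by rewrite -!gE linearZ.
Qed.

Lemma mulRKE (a b : RKel K r p) : mulRK a b =1 ofFree (act FreeK a (toFree b)).
Proof.
move=> m; rewrite /ofFree act_FreeE; apply: eq_bigr => m1 _; apply: eq_bigr => m2 _.
by rewrite ffunE.
Qed.

Lemma toFreeK (u : RKel K r p) : ofFree (toFree u) =1 u.
Proof. by move=> m; rewrite /ofFree ffunE. Qed.

(** No sums are rearranged: [mulRK a b] is [a] acting on [b] in the free module of rank one, and
    evaluation at [x] is a morphism. *)
Lemma act_mul (a b : RKel K r p) x : act N (mulRK a b) x = act N a (act N b x).
Proof.
have [ev [evm evE]] := act_ev x.
by rewrite (eq_act (mulRKE a b)) -evE tmorph_act // evE (eq_act (toFreeK b)).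
Qed.

Lemma oneRKE : oneRK K r p =1 ofFree (single r p0 (1 : K^o)).
Proof.
move=> m; rewrite /ofFree ffunE /oneRK; case: eqP => [->|m0].
  by rewrite (_ : [forall i, _] = true) //; apply/forallP => i; rewrite ffunE.
rewrite (_ : [forall i, _] = false) //; apply/negP => /forallP H; apply: m0.
by apply/ffunP => i; apply: val_inj; rewrite ffunE /= (eqP (H i)).
Qed.

Lemma act_single (x : N) : act N (ofFree (single r p0 (1 : K^o))) x = x.
Proof.
rewrite /act (bigD1 (mon0 r p0)) //= /ofFree ffunE eqxx scale1r monact0 big1 ?addr0 //.
by move=> m /negbTE mm; rewrite ffunE mm scale0r.
Qed.

Lemma act_pow (u : RKel K r p) k x : act N (powRK K r p u k) x = iter k (act N u) x.
Proof.
elim: k => [|k IH] /=; last by rewrite act_mul IH.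
by rewrite (eq_act oneRKE) act_single.
Qed.

Lemma act_pow0 (u : RKel K r p) x : (forall m, powRK K r p u p m = 0) ->
  iter p (act N u) x = 0.
Proof.
by move=> u0; rewrite -act_pow /act big1 // => m _; rewrite u0 scale0r.
Qed.

Lemma restrict_ax (u : RKel K r p) : (forall m, powRK K r p u p m = 0) ->
  tmod_ax p (restrict N u).
Proof. by move=> u0; split=> // i x; apply: act_pow0. Qed.
End Action.

Section Projective.
Variables (F : fieldType) (r p : nat) (M : tmod F r).
Hypotheses (p0 : (0 < p)%N) (aM : tmod_ax p M).

Lemma projective_retract : projective p M ->
  exists (h : {linear M -> Free r p M}) (g : {linear Free r p M -> M}),
    [/\ tmorph h, tmorph g & forall x, g (h x) = x].
Proof.
move=> pM; have [g [gm gE]] := Free_lift aM (idfun : {linear M -> M}).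
have gs y : exists x, g x = y.
  by exists (single r p0 y : Free r p M); rewrite gE Free_ev_single.
have [h [hm hE]] := pM _ _ (Free_ax _ _ _) aM g gm gs idfun (fun _ _ => erefl).
by exists h, g.
Qed.

Lemma projective_exact : projective p M -> exact p M.
Proof.
move=> /projective_retract[h [g [hm gm ghK]]] x sx.
have [i|y hy] := @Free_exact F r p M p0 (h x); first by rewrite -hm sx linear0.
exists (g y); rewrite -[x]ghK hy !sig_monfold.
by elim: (enum _) => // i s IH; rewrite !monfold_cons tmorph_iter ?IH.
Qed.

(** Averaging: with [s] a linear section of [g] and [Tr phi = 1], the lift is [Tr (s f phi)],
    because composing with [g] gives [Tr (f phi) = f (Tr phi) = f]. *)
Lemma exact_projective : exact p M -> projective p M.
Proof.
move=> eM N N' aN aN' g gm gs f fm.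
have [phi phiE] := higman p0 aM eM.
have [s [_ sE]] := linear_section g (@subspaceT _ N).
have [h hE] := linear_bundle (tr_linear p (enum 'I_r) (linearP (s \o (f \o phi)))).
exists h; split=> [i x|x]; rewrite !hE.
  by rewrite tr_comm ?mem_enum //; exact: linearP.
rewrite tr_compl // -[in RHS](phiE x) tr_compl //; apply: eq_tr => y /=.
by have [z <-] := gs (f (phi y)); exact: sE.
Qed.

Lemma projectiveP : projective p M <-> exact p M.
Proof. by split; [exact: projective_exact | exact: exact_projective]. Qed.
End Projective.

(** * Flatness *)

Lemma enum_I1 : enum 'I_1 = [:: ord0].
Proof. by apply: (inj_map val_inj); rewrite val_enum_ord. Qed.

Lemma exact1P (F : fieldType) p (T : tmod F 1) : exact p T <->
  forall x : T, top T ord0 x = 0 -> exists y, x = iter p.-1 (top T ord0) y.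
Proof.
rewrite /exact /sig enum_I1 /=; split=> H x Hx; apply: H => //.
by move=> i; rewrite ord1.
Qed.

(** Flatness yields [ker T^q] inside [im T], the socle criterion asks for [ker T] inside [im T^q].
    If [x = T^j y] with [j < q] and [T x = 0], then [T^q y = 0], so [y] is divisible by [T] once
    more. *)
Lemma ker_im_swap (F : fieldType) (V : lmodType F) (T : {linear V -> V}) q :
  (forall x, iter q T x = 0 -> exists y, x = T y) ->
  forall x, T x = 0 -> exists y, x = iter q T y.
Proof.
move=> H x Tx.
suff S j : (j <= q)%N -> exists y, x = iter j T y by exact: S.
elim: j => [|j IH] jq; first by exists x.
have [y xy] := IH (ltnW jq).
have [|z yz] := H y; last by exists z; rewrite iterSr -yz.
by rewrite -(subnK jq) iterD /= -xy Tx iter_lin0.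
Qed.

Section Flat.
Variables (K : fieldType) (r p : nat) (u : RKel K r p).
Hypothesis p1 : (1 < p)%N.
Notation I := (mon r p).
Let p0 : (0 < p)%N := ltnW p1.
Let S (m m' : I) : K := mulRK u (deltaRK K r p m) m'.

Lemma act_Free_matrix (V : lmodType K) (n : Free r p V) (j : I) :
  (act (Free r p V) u n : {ffun I -> V}) j = \sum_i S i j *: (n : {ffun I -> V}) i.
Proof.
rewrite act_FreeE /S /mulRK; under [RHS]eq_bigr do rewrite scaler_suml.
rewrite exchange_big /=; apply: eq_bigr => m1 _.
rewrite big_mkcond; apply: eq_bigr => m2 _; rewrite big_mkcond scaler_suml /=.
rewrite (bigD1 m2) //= /deltaRK eqxx mulr1 big1 ?addr0.
  by case: ifP => _; rewrite ?scale0r.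
by move=> m3 /negbTE ->; rewrite mulr0; case: ifP => _; rewrite scale0r.
Qed.

Section TruncatedPoly.
Variable V : lmodType K.

Definition tpoly_shift (f : {ffun 'I_p -> V}) : {ffun 'I_p -> V} :=
  [ffun j : 'I_p => \sum_(i : 'I_p | i.+1 == j) f i].

Lemma tpoly_shift_linear : linear tpoly_shift.
Proof.
move=> a x y; apply/ffunP => j; rewrite !ffunE scaler_sumr -big_split.
by apply: eq_bigr => m _; rewrite !ffunE.
Qed.

HB.instance Definition _ := GRing.isLinear.Build K {ffun 'I_p -> V} {ffun 'I_p -> V} *:%R
  tpoly_shift tpoly_shift_linear.

Definition tpoly : tmod K 1 := @TMod K 1 {ffun 'I_p -> V} (fun=> tpoly_shift).
Definition trivm : tmod K 1 := @TMod K 1 V (fun=> \0).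

Lemma iter_tpoly_shift k f (j : 'I_p) : (j < k)%N -> iter k tpoly_shift f j = 0.
Proof.
elim: k j => // k IH j jk; rewrite /= ffunE big1 // => i /eqP ij.
by apply: IH; rewrite -ltnS ij.
Qed.

Lemma tpoly_ax : tmod_ax p tpoly.
Proof.
by split=> // i x; apply/ffunP => j; rewrite iter_tpoly_shift ?ffunE.
Qed.

Lemma trivm_ax : tmod_ax p trivm.
Proof.
by split=> // i x; rewrite -(prednK p0).
Qed.

(* Flatness is applied to the socle inclusion of [V] into [V[t]/(t^p)]: the class of [n]
   dies in the second cokernel because [n t^(p-1)] is [u - t] times
   [- \sum_(j < p-1) (u^(p-2-j) n) t^j]. *)
Lemma flat_ker (n : Free r p V) : flat_alpha u ->
  iter p.-1 (act (Free r p V) u) n = 0 -> exists y, n = act (Free r p V) u y.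
Proof.
move=> fl; set U := act _ u => n0; have lt1 : (p.-1 < p)%N by rewrite prednK.
pose gf (v : V) : {ffun 'I_p -> V} := [ffun j : 'I_p => if j == p.-1 :> nat then v else 0].
have Lg : linear gf.
  move=> a x y; apply/ffunP => j; rewrite !ffunE; case: ifP => // _.
  by rewrite scaler0 addr0.
have [g gE] := linear_bundle Lg.
have [|||z Hz] := fl trivm tpoly trivm_ax tpoly_ax g _ _
  (fun m => (n : {ffun I -> V}) m).
- move=> i x; rewrite linear0 gE; apply/ffunP => j; rewrite !ffunE big1 // => l /eqP lj.
  rewrite ffunE ifF //; apply/eqP => lp; have := ltn_ord j.
  by rewrite -lj lp prednK // ltnn.
- move=> x y; rewrite !gE => /ffunP/(_ (Ordinal lt1)); rewrite !ffunE /=.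
  by rewrite eqxx.
- have [q pq] : exists q, p.-1 = q.+1 by exists p.-2; case: (p) p1 => [|[]].
  pose W k (m : I) := (iter k U n : {ffun I -> V}) m.
  pose Y (m : I) : {ffun 'I_p -> V} :=
    [ffun j : 'I_p => if j == q.+1 :> nat then 0 else - W (q - j)%N m].
  exists Y => m; rewrite gE; apply/ffunP => j; rewrite /tD !ffunE sum_ffunE pq.
  have jq : (j <= q.+1)%N by rewrite -pq -ltnS prednK.
  have -> : \sum_(i : 'I_p | i.+1 == j) Y m i =
      if j == 0 :> nat then 0 else - W (q.+1 - j)%N m.
    case: (j) jq => -[|j' lj] /= jq; first by rewrite big_pred0.
    rewrite (big_pred1 (Ordinal (ltnW lj))) /=; last first.
      by move=> i; rewrite /= -[RHS](inj_eq val_inj) /= eqSS.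
    by rewrite ffunE /= ltn_eqF // subSS.
  have [jE|jE] := eqVneq (j : nat) q.+1.
    rewrite jE /= subnn big1 ?sub0r ?opprK // => i _.
    by rewrite !ffunE jE eqxx scaler0.
  have jq' : (j <= q)%N by rewrite -ltnS ltn_neqAle jE.
  rewrite (eq_bigr (fun i => - (S i m *: W (q - j)%N i))); last first.
    by move=> i _; rewrite !ffunE (negbTE jE) scalerN.
  rewrite sumrN -act_Free_matrix -/U -iterS -subSn // -/(W _ m).
  case: eqP => [j0|_]; last by rewrite opprK addNr.
  by rewrite j0 subn0 /W -pq n0 ffunE !oppr0 addr0.
exists [ffun m => z m]; apply/ffunP => m; rewrite act_Free_matrix Hz /tD /= subr0.
by apply: eq_bigr => i _; rewrite ffunE.
Qed.
End TruncatedPoly.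

(** [N] is a retract of a free module, both maps commute with the action of [u], and for free
    modules the claim is [flat_ker]. *)
Lemma exact_flat (N : tmod K r) : tmod_ax p N -> exact p N ->
  (forall m, powRK K r p u p m = 0) -> flat_alpha u -> exact p (restrict N u).
Proof.
move=> aN eN u0 fl; apply/exact1P => x /= ux.
have [h [g [hm gm ghK]]] := projective_retract p0 aN (exact_projective p0 aN eN).
have hx : act (Free r p N) u (h x) = 0 by rewrite -(tmorph_act u x hm) ux linear0.
have [y hy] := ker_im_swap (fun y => @flat_ker N y fl) hx.
exists (g y); rewrite -[x]ghK hy; elim: (p.-1) => //= k <-.
by rewrite (tmorph_act u _ gm).
Qed.

(** * Endomorphisms of [R_K] extended to [R_K (x) L] *)

Section Extension.
Variable L : lmodType K.
Notation FK := (FreeK K r p).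
Notation FL := {ffun I -> L}.

Definition dlt (i : I) : FK := [ffun m => (m == i)%:R].

Lemma dlt_decomp (n : FK) : n = \sum_i (n : {ffun I -> K^o}) i *: dlt i.
Proof.
apply/ffunP => j; rewrite sum_ffunE (bigD1 j) //= !ffunE eqxx [_ *: _]mulr1.
by rewrite big1 ?addr0 // => i /negbTE ij; rewrite !ffunE eq_sym ij scaler0.
Qed.

(** The map [E (x) L] on [R_K (x)_K L], given by the matrix of [E] in the monomial basis. *)
Definition ext (E : FK -> FK) (y : FL) : FL :=
  [ffun j : I => \sum_i (E (dlt i) : {ffun I -> K^o}) j *: y i].

Lemma ext_linear E : linear (ext E).
Proof.
move=> a x y; apply/ffunP => j; rewrite !ffunE scaler_sumr -big_split.
by apply: eq_bigr => i _; rewrite !ffunE /= scalerDr !scalerA mulrC.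
Qed.

HB.instance Definition _ E := GRing.isLinear.Build K FL FL *:%R (ext E) (ext_linear E).

Lemma ext_comp (E : {linear FK -> FK}) (E' : FK -> FK) y :
  ext E (ext E' y) = ext (E \o E') y.
Proof.
apply/ffunP => j; rewrite !ffunE.
under eq_bigr do rewrite ffunE scaler_sumr.
rewrite exchange_big; apply: eq_bigr => i _ /=.
rewrite {2}[E' (dlt i)]dlt_decomp linear_sum sum_ffunE scaler_suml.
by apply: eq_bigr => l _; rewrite scalerA [E (_ *: _)]linearZ ffunE mulrC.
Qed.

Lemma ext_id y : ext id y = y.
Proof.
apply/ffunP => j; rewrite ffunE (bigD1 j) //= ffunE eqxx scale1r big1 ?addr0 //.
by move=> i /negbTE ij; rewrite ffunE eq_sym ij scale0r.
Qed.

Lemma eq_ext E E' y : E =1 E' -> ext E y = ext E' y.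
Proof. by move=> /funext ->. Qed.

Lemma iter_ext_comp (E : {linear FK -> FK}) (E' : FK -> FK) k y :
  iter k (ext E) (ext E' y) = ext (iter k E \o E') y.
Proof. by elim: k => [|k IH] //=; rewrite IH ext_comp. Qed.

Lemma iter_ext (E : {linear FK -> FK}) k y : iter k (ext E) y = ext (iter k E) y.
Proof. by rewrite -{1}[y]ext_id iter_ext_comp. Qed.

Lemma ext_sum (J : finType) (E : J -> FK -> FK) y :
  ext (fun n => \sum_j E j n) y = \sum_j ext (E j) y.
Proof.
apply/ffunP => m; rewrite ffunE sum_ffunE.
under eq_bigr do rewrite sum_ffunE scaler_suml.
by rewrite exchange_big; apply: eq_bigr => j _; rewrite ffunE.
Qed.
End Extension.

Section Twist.
Variable L : tmod K 1.
Notation FL := {ffun I -> L}.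

Definition ptop (y : FL) : FL := [ffun j => top L ord0 (y j)].

Lemma ptop_linear : linear ptop.
Proof. by move=> a x y; apply/ffunP => j; rewrite !ffunE linearP. Qed.

HB.instance Definition _ := GRing.isLinear.Build K FL FL *:%R ptop ptop_linear.

(** The two actions of [t] on [R_K (x)_K L]: on the factor [L] here, through [u] in [modU]. The
    cokernel of their difference is the tensor product over [K[t]/(t^p)]. *)
Definition modT : tmod K 1 := @TMod K 1 FL (fun=> ptop).
Definition modU : tmod K 1 := @TMod K 1 FL (fun=> ext (act (FreeK K r p) u)).

Lemma ptop_ext E y : ptop (ext E y) = ext E (ptop y).
Proof.
apply/ffunP => j; rewrite !ffunE linear_sum; apply: eq_bigr => i _.
by rewrite linearZ ffunE.
Qed.

Lemma modT_ax : tmod_ax p L -> tmod_ax p modT.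
Proof.
move=> [_ nL]; split=> // i x; apply/ffunP => j; rewrite [in RHS]ffunE -(nL ord0 (x j)).
suff H k : (iter k ptop x) j = iter k (top L ord0) (x j) by exact: H.
by elim: k => //= k IH; rewrite ffunE IH.
Qed.

Lemma modU_ax : (forall m, powRK K r p u p m = 0) -> tmod_ax p modU.
Proof.
move=> u0; split=> // i x; rewrite /= iter_ext; apply/ffunP => j; rewrite !ffunE big1 // => l _.
by rewrite (act_pow0 p0 (Free_ax r p K^o)) // ffunE scale0r.
Qed.
End Twist.

(* If [\sum_j u^j phi u^(p-1-j) = 1] on [R_K], then [tau = \sum_j t^j phi u^(p-1-j)]
   annihilates the image of [u - t] on [R_K (x) L] and is the identity modulo that image;
   being natural in [L], it reduces the flatness condition to injectivity of [g]. *)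
Lemma exact_flat_alpha : (forall m, powRK K r p u p m = 0) ->
  exact p (restrict (FreeK K r p) u) -> flat_alpha u.
Proof.
move=> u0 eu; set U := act (FreeK K r p) u.
have aF := Free_ax r p K^o; have aR := restrict_ax p0 aF u0.
have [phi phiE] := higman p0 aR eu.
rewrite enum_I1 /= in phiE.
move=> L1 L2 aL1 aL2 g gm ginj x [y xy].
pose tau (L : tmod K 1) : {ffun I -> L} -> {ffun I -> L} :=
  tr1 p (M := modU L) (N := modT L) ord0 (ext phi).
have tauD (L : tmod K 1) (aL : tmod_ax p L) w : tau L (ext U w - ptop w) = 0.
  have Lt := tr1_linear p (M := modU L) (N := modT L) ord0 (@ext_linear L phi).
  have [T TE] := linear_bundle Lt.
  rewrite /tau -TE linearB !TE -[ext U w]/(top (modU L) ord0 w).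
  rewrite -(tr1_top _ _ (modU_ax _ u0) (modT_ax aL)) //; last exact: ext_linear.
  have H1 : @tmorph _ _ (modT L) (modT L) (@ptop L) by [].
  have H2 : @tmorph _ _ (modU L) (modU L) (@ptop L) by move=> i z; exact: ptop_ext.
  have := tr_compl p (ext phi : modU L -> modT L) [:: ord0] H1 w.
  have := tr_compr p (ext phi : modU L -> modT L) [:: ord0] H2 w.
  rewrite /= => -> ->; apply/eqP; rewrite subr_eq0; apply/eqP.
  by apply: (@eq_tr _ _ p (modU L) (modT L) _ _ [:: ord0]) => z /=; exact: ptop_ext.
have modD (L : tmod K 1) (w : {ffun I -> L}) k :
    exists z, iter k (@ptop L) w = iter k (ext U) w + (ext U z - ptop z).
  elim: k => [|k [z Hz]] /=; first by exists 0; rewrite !linear0 !addr0.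
  exists (ptop z - iter k (ext U) w); rewrite Hz; set v := iter k _ w.
  rewrite [ptop (v + _)]linearD /= [ptop (_ - ptop z)]linearB /= [ext U (_ - v)]linearB [ptop (_ - v)]linearB /=.
  rewrite ptop_ext opprB [RHS]addrA [ext U v + _]addrC.
  by rewrite subrK addrCA.
have trU (L : tmod K 1) (w : {ffun I -> L}) :
    \sum_(j < p) iter j (ext U) (ext phi (iter (p.-1 - j) (ext U) w)) = w.
  rewrite -[RHS]ext_id -(eq_ext _ phiE) [RHS]ext_sum; apply: eq_bigr => j _.
  by rewrite [iter (_ - _) _ _]iter_ext ext_comp iter_ext_comp.
have tau_id (L : tmod K 1) w : exists z, w = tau L w + (ext U z - ptop z).
  have [z Hz] := choice (fun j : 'I_p =>
    modD L (ext phi (iter (p.-1 - j) (ext U) w)) j).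
  exists (- \sum_j z j); rewrite -[LHS]trU /tau /tr1 /=.
  rewrite (eq_bigr _ (fun j _ => Hz j)) big_split /=.
  rewrite -[X in _ = _ + X]/((ext U \- @ptop L) (- \sum_j z j)).
  by rewrite linearN linear_sum addrK.
pose G (w : {ffun I -> L1}) : {ffun I -> L2} := [ffun i => g (w i)].
have LG : linear G by move=> a v w; apply/ffunP => j; rewrite !ffunE linearP.
have [GG GGE] := linear_bundle LG.
have Gext E w : G (ext E w) = ext E (G w).
  apply/ffunP => j; rewrite !ffunE linear_sum; apply: eq_bigr => i _.
  by rewrite linearZ ffunE.
have Gtop w : G (ptop w) = ptop (G w) by apply/ffunP => j; rewrite !ffunE gm.
have Gtau w : G (tau L1 w) = tau L2 (G w).
  rewrite /tau /tr1 -GGE linear_sum; apply: eq_bigr => j _ /=; rewrite GGE.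
  rewrite -[RHS]/(iter j (@ptop L2) (ext phi (iter (p.-1 - j) (ext U) (G w)))).
  have H1 k v : iter k (ext U) (G v) = G (iter k (ext U) v).
    by elim: k => //= k ->; rewrite Gext.
  have H2 k v : iter k (@ptop L2) (G v) = G (iter k (@ptop L1) v).
    by elim: k => //= k ->; rewrite Gtop.
  by rewrite H1 -Gext H2.
have tD_E (L : tmod K 1) (z : {ffun I -> L}) j :
    tD S (fun i => z i) j = (ext U z - ptop z : {ffun I -> L}) j.
  rewrite /tD !ffunE; congr (_ - _); apply: eq_bigr => i _.
  congr (_ *: _); rewrite /U act_Free_matrix (bigD1 i) //= ffunE eqxx.
  rewrite [_ *: _]mulr1 big1 ?addr0 // => l /negbTE li.
  by rewrite ffunE li scaler0.
have [z xz] := tau_id L1 [ffun i => x i].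
have t0 : tau L1 [ffun i => x i] = 0.
  have H : G (tau L1 [ffun i => x i]) = 0.
    rewrite Gtau -(tauD L2 aL2 [ffun i => y i]); congr (tau _ _); apply/ffunP => j.
    rewrite -tD_E !ffunE xy /tD; congr (_ - _); last by rewrite ffunE.
    by apply: eq_bigr => i _; rewrite ffunE.
  apply/ffunP => j; apply: ginj; move/ffunP/(_ j): H; rewrite ffunE => ->.
  by rewrite !ffunE linear0.
exists (fun j => z j) => j; rewrite tD_E.
by move/ffunP/(_ j): xz; rewrite t0 add0r => <-; rewrite ffunE.
Qed.
End Flat.

(** * Adjoining an operator *)

Section Cons.
Variables (F : fieldType) (p : nat).
Hypothesis p0 : (0 < p)%N.

Definition tail r (M : tmod F r.+1) : tmod F r :=
  @TMod F r M (fun i => top M (lift ord0 i)).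

Definition tcons r (M : tmod F r) (T : {linear M -> M}) : tmod F r.+1 :=
  @TMod F r.+1 M (fun i => if unlift ord0 i is Some j then top M j else T).

Variables (r : nat) (M : tmod F r) (T : {linear M -> M}).

Lemma tcons0 x : top (tcons T) ord0 x = T x.
Proof. by rewrite /= unlift_none. Qed.

Lemma tconsS i x : top (tcons T) (lift ord0 i) x = top M i x.
Proof. by rewrite /= liftK. Qed.

Lemma tcons_kill x : (forall i, top (tcons T) i x = 0) <->
  T x = 0 /\ forall i, top M i x = 0.
Proof.
split=> [H|[Tx Mx] i].
  by split=> [|i]; [rewrite -tcons0 H | rewrite -tconsS H].
by case: (unliftP ord0 i) => [j|] ->; rewrite ?tconsS ?tcons0.
Qed.

Lemma sig_tail (N : tmod F r.+1) (x : N) :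
  sig p x = iter p.-1 (top N ord0) (sig p (x : tail N)).
Proof.
by rewrite /sig enum_ordSl /=; congr (iter _ _ _); elim: (enum _) => //= i s ->.
Qed.

Lemma eq_sig (N : tmod F r) (t : 'I_r -> {linear N -> N}) (x : N) :
  (forall i y, t i y = top N i y) -> sig p (x : TMod F r N t) = sig p x.
Proof.
move=> H; rewrite /sig; elim: (enum _) => //= i s ->.
by elim: (p.-1) => //= k ->.
Qed.

Lemma sig_tcons (x : M) : sig p (x : tcons T) = iter p.-1 T (sig p x).
Proof.
rewrite sig_tail; set s1 := sig p _.
have -> : s1 = sig p x by apply: (@eq_sig M) => i y; exact: tconsS.
by elim: (p.-1) => // k IH; rewrite !iterS IH tcons0.
Qed.

Lemma tcons_ax : tmod_ax p M -> (forall x, iter p T x = 0) ->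
  (forall i x, T (top M i x) = top M i (T x)) -> tmod_ax p (tcons T).
Proof.
move=> [cM nM] nT cT; split=> [i j x|i x].
  case: (unliftP ord0 i) => [i'|] ->; case: (unliftP ord0 j) => [j'|] ->;
    by rewrite ?tconsS ?tcons0 ?tconsS ?tcons0.
case: (unliftP ord0 i) => [i'|] ->.
  by rewrite -[RHS](nM i' x); elim: (p) => //= k <-; rewrite liftK.
by rewrite -[RHS](nT x); elim: (p) => //= k <-; rewrite unlift_none.
Qed.

Lemma tail_ax (N : tmod F r.+1) : tmod_ax p N -> tmod_ax p (tail N).
Proof. by move=> [cN nN]; split=> [i j x|i x]; [exact: cN | exact: nN]. Qed.

(** Induction on the least power of [T] killing [x] in the socle of [M]. If [T^(j+1) x = 0], then
    [T^j x] lies in the joint socle, so [T^j x = T^(p-1) sigma y], and [T^j] kills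
    [x - T^(p-1-j) sigma y]. *)
Lemma exact_tcons_tl : tmod_ax p M -> (forall x, iter p T x = 0) ->
  (forall i x, T (top M i x) = top M i (T x)) -> exact p (tcons T) -> exact p M.
Proof.
move=> aM nT cT eT.
have [s sE] := linear_bundle (@sig_linear _ _ p M).
suff H j (x : M) : iter j T x = 0 -> (forall i, top M i x = 0) -> exists y, x = sig p y.
  by move=> x; apply: (H p).
elim: j x => [|j IH] x /= Tx Mx; first by exists 0; rewrite Tx -sE linear0.
have [jp|pj] := leqP p j.
  by apply: IH => //; apply: (iter_ge x nT).
have [|y xy] := eT (iter j T x).
  by apply/tcons_kill; split=> // i; rewrite iter_comm ?Mx ?iter_lin0 // => y; rewrite cT.
rewrite sig_tcons in xy.
have cTs z : T (s z) = s (T z) by rewrite !sE sigs_comm.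
have [||z xz] := IH (x - iter (p.-1 - j) T (s y)).
- by rewrite iter_linB -iterD subnKC ?sE -?xy ?subrr // -ltnS prednK.
- by move=> i; rewrite linearB Mx sE iter_comm ?sig_kill ?iter_lin0 ?subrr.
exists (z + iter (p.-1 - j) T y); rewrite -sE linearD sE -xz.
rewrite [s (iter _ _ _)]iter_comm; last by move=> w; rewrite cTs.
by rewrite subrK.
Qed.
End Cons.

(** * Pencils of operators *)

Section Pencil.
Variables (F : fieldType) (V : lmodType F) (a b T : {linear V -> V}) (al be : F).
Hypothesis ab : forall x, a (b x) = b (a x).
Hypothesis TE : forall x, T x = al *: a x + be *: b x.

(** The expansion is homogeneous in the commuting [a] and [b], so its coefficients are read off in
    [F[X]], where Frobenius and cancellation are available. *)
Lemma iter_pencil n x : iter n T x =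
  \sum_(i < n.+1) ((al%:P + be *: 'X) ^+ n)`_i *: iter (n - i) a (iter i b x).
Proof.
elim: n => [|n IH]; first by rewrite big_ord1 expr0 coef1 scale1r.
set P := al%:P + be *: 'X in IH *.
have sP : (size (P ^+ n) <= n.+1)%N.
  apply: leq_trans (size_poly_exp_leq _ _) _; rewrite ltnS -[leqRHS]mul1n leq_mul2r.
  have -> : ((size P).-1 <= 1)%N; last by rewrite orbT.
  suff H : (size P <= 2)%N by case: (size P) H.
  rewrite (leq_trans (size_polyD _ _)) //.
  rewrite geq_max size_polyC (leq_trans (leq_b1 _)) //.
  by rewrite (leq_trans (size_scale_leq _ _)) // size_polyX.
have cP i : (P ^+ n.+1)`_i = al * (P ^+ n)`_i + be * (if i == 0 then 0 else (P ^+ n)`_i.-1).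
  by rewrite exprS mulrDl coefD coefCM -scalerAl coefZ coefXM.
under [RHS]eq_bigr do rewrite cP scalerDl.
rewrite big_split /= big_ord_recr /= [(P ^+ n)`_n.+1]nth_default // mulr0 scale0r addr0.
rewrite [X in _ + X]big_ord_recl /= mulr0 scale0r add0r IH TE !linear_sum /=.
congr (_ + _); apply: eq_bigr => i _; rewrite !linearZ /= !scalerA.
  by rewrite mulrC (subSn (ltn_ord i : (i <= n)%N)).
by rewrite mulrC /bump /= add1n subSS iter_comm.
Qed.

Variable p : nat.
Hypothesis pF : p \in [pchar F].
Let p_prime := pcharf_prime pF.
Let p0 : (0 < p)%N := prime_gt0 p_prime.
Hypothesis (na : forall x, iter p a x = 0) (nb : forall x, iter p b x = 0).

Lemma pencil_nil x : iter p T x = 0.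
Proof.
have pP : p \in [pchar {poly F}] by rewrite pchar_poly.
rewrite iter_pencil -(pFrobenius_autE pP) pFrobenius_autD_comm; last exact: mulrC.
rewrite !pFrobenius_autE big1 // => i _; rewrite exprZn -rmorphXn /= coefD coefC coefZ coefXn.
have [i0|i0] := eqVneq (i : nat) 0%N; first by rewrite i0 subn0 na scaler0.
have [->|ip] := eqVneq (i : nat) p; first by rewrite nb iter_lin0 scaler0.
by rewrite mulr0 addr0 scale0r.
Qed.
End Pencil.

Section Pencil1.
Variables (F : fieldType) (V : lmodType F) (a b T : {linear V -> V}) (lam : F) (p : nat).
Hypothesis ab : forall x, a (b x) = b (a x).
Hypothesis TE : forall x, T x = a x - lam *: b x.
Hypothesis pF : p \in [pchar F].
Let p0 : (0 < p)%N := prime_gt0 (pcharf_prime pF).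
Hypothesis (na : forall x, iter p a x = 0) (nb : forall x, iter p b x = 0).

Let TE' x : T x = 1 *: a x + - lam *: b x.
Proof. by rewrite TE scale1r scaleNr. Qed.

Lemma pencil1_nil x : iter p T x = 0.
Proof. exact: (pencil_nil ab TE' pF na nb). Qed.

(* In [F[X]], [(1 - lam X)^(p-1)] is the quotient of [1 - (lam X)^p] by [1 - lam X]. *)
Lemma iter_pencil1 x :
  iter p.-1 T x = \sum_(i < p) lam ^+ i *: iter (p.-1 - i) a (iter i b x).
Proof.
have pP : p \in [pchar {poly F}] by rewrite pchar_poly.
have E : (1%:P + (- lam) *: 'X) ^+ p.-1 = \sum_(i < p) (lam *: 'X) ^+ i :> {poly F}.
  have nz : 1%:P + (- lam) *: 'X != 0 :> {poly F}.
    apply/eqP => /(congr1 (fun q : {poly F} => q`_0)) /eqP.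
    by rewrite coefD coefC coefZ coefX mulr0 addr0 coef0 oner_eq0.
  apply: (mulfI nz); rewrite -exprS prednK // scaleNr.
  have /eqP := subrXX (1 : {poly F}) (lam *: 'X) p.
  under eq_bigr do rewrite expr1n mul1r.
  rewrite expr1n polyC1 => /eqP <-.
  rewrite -!(pFrobenius_autE pP) pFrobenius_autD_comm; last exact: mulrC.
  by rewrite rmorphN /= pFrobenius_aut1.
rewrite (iter_pencil ab TE') (prednK p0) E; apply: eq_bigr => i _; congr (_ *: _).
under eq_bigr do rewrite exprZn.
rewrite coef_sum (bigD1 i) //= coefZ coefXn eqxx mulr1 big1 ?addr0 // => j ji.
by rewrite coefZ coefXn eq_sym (inj_eq val_inj) (negbTE ji) mulr0.
Qed.

(** Every term but [a^(p-1)] contains [b] and dies on [b^(p-1)]. Hence the pairs [(a, b)] and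
    [(a - lam b, b)] have the same [sigma]. *)
Lemma pencil1_socle x : iter p.-1 T (iter p.-1 b x) = iter p.-1 a (iter p.-1 b x).
Proof.
rewrite iter_pencil1; case: (p) p0 nb => // q _ nbq.
rewrite big_ord_recl /= subn0 expr0 scale1r big1 ?addr0 // => i _.
by rewrite -[b (iter _ _ _)]iterS -iterD (iter_ge _ nbq) ?iter_lin0 ?scaler0 // addSn ltnS leq_addl.
Qed.

(** Origin of [lam^p]: since [b z = a y], the terms [lam^(i+1) a^(p-2-i) b^(i+1) z] cancel against
    [lam (lam^i a^(p-1-i) b^i y)], and only the first term in [z] and the last in [y] survive. *)
Lemma pencil1_bockstein y z : b z = a y ->
  iter p.-1 T (z - lam *: y) = iter p.-1 a z - lam ^+ p *: iter p.-1 b y.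
Proof.
move=> bz; rewrite iter_linB iter_linZ !iter_pencil1; case: (p) p0 => // q _.
rewrite big_ord_recl [X in _ - _ *: X]big_ord_recr /= subn0 subnn expr0 scale1r.
rewrite scalerDr scalerA -exprS opprD addrA; congr (_ - _).
rewrite -[RHS]addr0 -addrA; congr (_ + _); apply/eqP; rewrite subr_eq0 scaler_sumr; apply/eqP.
apply: eq_bigr => i _; rewrite scalerA -exprS /bump /= add1n; congr (_ *: _).
rewrite -iterS iterSr bz -[iter i b (a y)]iter_comm // -iterSr.
by rewrite subnSK.
Qed.
End Pencil1.

(** * Subfields and the generic map *)

Section SubField.
Variables (L : fieldType) (P : L -> Prop).

Definition subfield_closed :=
  [/\ P 1, forall x y, P x -> P y -> P (x - y) & forall x y, P x -> P y -> P (x / y)].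

Variable H : subfield_closed.
(** The closure proof is an argument so that the algebraic structure can be inferred from the
    predicate itself. *)
Definition sfpred of subfield_closed : {pred L} := fun z => `[<P z>].

Lemma sfpred_closed : divring_closed (sfpred H).
Proof.
have [P1 PB PV] := H; split; first exact/asboolP.
  by move=> x y /asboolP Px /asboolP Py; apply/asboolP; exact: PB.
by move=> x y /asboolP Px /asboolP Py; apply/asboolP; exact: PV.
Qed.

HB.instance Definition _ := GRing.isDivringClosed.Build L (sfpred H) sfpred_closed.

Definition sfield : Type := {z : L | z \in sfpred H}.
HB.instance Definition _ := [isSub of sfield for sval].
HB.instance Definition _ := [Choice of sfield by <:].
HB.instance Definition _ := [SubChoice_isSubIntegralDomain of sfield by <:].
HB.instance Definition _ := [SubIntegralDomain_isSubField of sfield by <:].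

Lemma sfieldP (z : sfield) : P (val z).
Proof. by have /asboolP := valP z. Qed.

Lemma sfield_sub z : P z -> exists x : sfield, val x = z.
Proof. by move=> /asboolP zP; exists (exist _ z zP). Qed.
Definition sfval : {rmorphism sfield -> L} := val.
End SubField.

Lemma sfield_lift (A L : fieldType) (P : L -> Prop) (H : subfield_closed P)
    (f : {rmorphism A -> L}) : (forall a, P (f a)) ->
  exists g : {rmorphism A -> sfield H}, forall a, val (g a) = f a.
Proof.
move=> fP; have [g gE] := choice (fun a => sfield_sub H (fP a)).
have gB : zmod_morphism g.
  by move=> x y; apply: val_inj; rewrite rmorphB /= !gE rmorphB.
have gM : monoid_morphism g.
  split=> [|x y]; apply: val_inj; first by rewrite rmorph1 /= gE rmorph1.
  by rewrite rmorphM /= !gE rmorphM.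
pose g1 := GRing.isZmodMorphism.Build A (sfield H) g gB.
pose g2 := GRing.isMonoidMorphism.Build A (sfield H) g gM.
by exists (HB.pack_for {rmorphism A -> sfield H} g g1 g2).
Qed.

Section Fractions.
Variables (D : comNzRingType) (L : fieldType) (e : {rmorphism D -> L}).

Definition fracs (z : L) := exists P Q, e Q != 0 /\ z * e Q = e P.

Lemma fracs_in P : fracs (e P).
Proof. by exists P, 1; rewrite rmorph1 mulr1 oner_eq0. Qed.

Lemma fracs_closed : subfield_closed fracs.
Proof.
split; first by rewrite -(rmorph1 e); exact: fracs_in.
  move=> x y [P [Q [Q0 xQ]]] [P' [Q' [Q'0 yQ]]].
  exists (P * Q' - P' * Q), (Q * Q'); rewrite rmorphM mulf_neq0 // rmorphB !rmorphM -xQ -yQ.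
  by split=> //; ring.
move=> x y [P [Q [Q0 xQ]]] [P' [Q' [Q'0 yQ]]].
have [->|y0] := eqVneq y 0.
  by exists 0, 1; rewrite invr0 mulr0 mul0r rmorph1 oner_eq0 rmorph0.
exists (P * Q'), (Q * P'); rewrite !rmorphM -yQ -xQ !mulf_neq0 //; split=> //.
by field.
Qed.
End Fractions.

Section HomSpace.
Variables (k K : fieldType) (iota : {rmorphism k -> K}).

Definition KkL : lmodType k := Defs_Kk__canonical__GRing_Lmodule k K iota.

Lemma MKt_lin (V : lmodType k) (g : MKt k K iota V) a (x y : K) :
  val g (iota a * x + y) = a *: val g x + val g y.
Proof. exact: (klinP k K iota V _ (valP g) a x y). Qed.

Lemma MKt_add (V : lmodType k) (g : MKt k K iota V) (x y : K) :
  val g (x + y) = val g x + val g y.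
Proof. by have := MKt_lin g 1 x y; rewrite rmorph1 mul1r scale1r. Qed.

Lemma MKt_mul (V : lmodType k) (g : MKt k K iota V) a (x : K) :
  val g (iota a * x) = a *: val g x.
Proof.
have g0 : val g (0 : K) = 0.
  by apply: (@addrI _ (val g (0 : K))); rewrite -MKt_add !addr0.
by have := MKt_lin g a x 0; rewrite g0 !addr0.
Qed.

Lemma MKt_ex (V : lmodType k) (g : K -> V) :
  (forall a x y, g (iota a * x + y) = a *: g x + g y) ->
  exists h : MKt k K iota V, val h = g.
Proof.
move=> Lg; have gin : klin k K iota V g by apply/asboolP => a x y; exact: Lg.
by exists (exist _ g gin).
Qed.

Lemma MKt_ext (V : lmodType k) (g h : MKt k K iota V) : val g =1 val h -> g = h.
Proof. by move=> gh; apply/val_inj/funext. Qed.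

Lemma MKt_functional : exists f : {linear KkL -> k^o}, f (1 : K) = 1.
Proof. exact: (@linear_functional k KkL (1 : K) (oner_neq0 K)). Qed.
End HomSpace.

(** * Vector spaces with an operator, as modules over [k[X]] and [k(X)] *)

Section PolyAction.
Variables (k : fieldType) (V : lmodType k) (f : {linear V -> V}).

Definition pact (P : {poly k}) (w : V) : V := \sum_(i < size P) P`_i *: iter i f w.

Lemma pactE n (P : {poly k}) w : (size P <= n)%N ->
  pact P w = \sum_(i < n) P`_i *: iter i f w.
Proof.
move=> Pn; rewrite /pact (big_ord_widen _ (fun i => P`_i *: iter i f w) Pn) big_mkcond.
by apply: eq_bigr => i _; case: ltnP => // iP; rewrite nth_default ?scale0r.
Qed.

Lemma pact_linear P : linear (pact P).
Proof.
move=> a x y; rewrite /pact scaler_sumr -big_split; apply: eq_bigr => i _ /=.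
by rewrite iter_linear scalerDr !scalerA mulrC.
Qed.

Lemma pactD P Q w : pact (P + Q) w = pact P w + pact Q w.
Proof.
have sPQ := size_polyD P Q.
rewrite (pactE _ sPQ) (pactE _ (leq_maxl _ _ : (size P <= maxn (size P) (size Q))%N)).
rewrite (pactE _ (leq_maxr _ _ : (size Q <= maxn (size P) (size Q))%N)) -big_split.
by apply: eq_bigr => i _; rewrite coefD scalerDl.
Qed.

Lemma pactC c w : pact c%:P w = c *: w.
Proof. by rewrite (pactE _ (size_polyC_leq1 c)) big_ord1 coefC. Qed.

Lemma pactMX P w : pact (P * 'X) w = pact P (f w).
Proof.
rewrite (@pactE (size P).+1); last first.
  by rewrite (leq_trans (size_polyMleq _ _)) // size_polyX addn2.
rewrite big_ord_recl coefMX scale0r add0r; apply: eq_bigr => i _.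
by rewrite coefMX -iterSr.
Qed.

Lemma pact_comm (g : {linear V -> V}) P w : (forall x, g (f x) = f (g x)) ->
  g (pact P w) = pact P (g w).
Proof.
move=> gf; rewrite linear_sum; apply: eq_bigr => i _.
by rewrite linearZ iter_comm.
Qed.

Lemma pactM P Q w : pact (P * Q) w = pact P (pact Q w).
Proof.
elim/poly_ind: P w => [|P c IH] w.
  by rewrite mul0r /pact size_poly0 !big_ord0.
rewrite mulrDl !pactD pactC [P * 'X * Q]mulrAC !pactMX IH (@pact_comm f) //.
congr (_ + _); rewrite mul_polyC (@pactE (size Q)) ?size_scale_leq //.
by rewrite /pact scaler_sumr; apply: eq_bigr => i _; rewrite coefZ scalerA.
Qed.
End PolyAction.

Definition is_closed (k : fieldType) :=
  forall q : {poly k}, size q != 1 -> exists z, root q z.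

Section GenericMap.
Variables (k L : fieldType) (j : {rmorphism k -> L}) (X : L).
Hypothesis (kcl : is_closed k) (Xtr : forall c, j c != X).
Variables (V : lmodType k) (S : V -> Prop) (f : {linear V -> V}).
Hypothesis (sS : subspace S) (fS : forall v, S v -> S (f v)).
Hypothesis (finj : forall c v, S v -> f v = c *: v -> v = 0).
Hypothesis (fsurj : forall c v, S v -> exists2 w, S w & f w - c *: w = v).

(** Over an algebraically closed field, facts about [P(X)] or [P(f)] reduce to linear factors. *)
Lemma split_ind (Q : {poly k} -> Prop) :
  (forall c, c != 0 -> Q c%:P) -> (forall P r, P != 0 -> Q P -> Q (P * ('X - r%:P))) ->
  forall P, P != 0 -> Q P.
Proof.
move=> Q0 QS P; have [n] := ubnP (size P); elim: n P => // n IH P Pn P0.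
have [/size_poly1P[c c0 ->]|P1] := boolP (size P == 1); first exact: Q0.
have [r /factor_theorem [P' PE]] := kcl P1; rewrite PE.
have P'0 : P' != 0 by apply: contraNneq P0 => P'0; rewrite PE P'0 mul0r.
apply: (QS _ _ P'0); apply: IH => //; move: Pn; rewrite PE size_Mmonic ?monicXsubC //.
by rewrite size_XsubC addn2.
Qed.

Definition ev : {rmorphism {poly k} -> L} := horner_eval X \o map_poly j.

Lemma evC c : ev c%:P = j c.
Proof. by rewrite /ev /= /horner_eval map_polyC hornerC. Qed.

Lemma evX : ev 'X = X.
Proof. by rewrite /ev /= /horner_eval map_polyX hornerX. Qed.

(** An element outside an algebraically closed field is transcendental over it: no linear factor
    vanishes at [X]. *)
Lemma ev_neq0 P : P != 0 -> ev P != 0.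
Proof.
move: P; apply: (split_ind (Q := fun P => ev P != 0)) => [c c0|P' r _ H].
  by rewrite evC fmorph_eq0.
by rewrite rmorphM mulf_neq0 // rmorphB evX evC subr_eq0 eq_sym.
Qed.

Lemma ev_inj P Q : ev P = ev Q -> P = Q.
Proof.
move=> E; apply/eqP; rewrite -subr_eq0; apply: contraT => /ev_neq0.
by rewrite rmorphB E subrr eqxx.
Qed.

Lemma pactS P v : S v -> S (pact f P v).
Proof.
move=> Sv; elim/poly_ind: P v Sv => [v _|P c IH v Sv].
  by rewrite /pact size_poly0 big_ord0; case: sS.
by rewrite pactD pactMX pactC; apply: subspaceD (IH _ (fS Sv)) (subspaceZ _ _ _).
Qed.

Lemma pact_XsubC r v : pact f ('X - r%:P) v = f v - r *: v.
Proof.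
by rewrite -polyCN pactD pactC -['X]mul1r pactMX -polyC1 pactC scale1r scaleNr.
Qed.

Lemma pact_inj P v : P != 0 -> S v -> pact f P v = 0 -> v = 0.
Proof.
move=> P0; move: P P0 v.
apply: (split_ind (Q := fun P => forall v, S v -> pact f P v = 0 -> v = 0)) =>
  [c c0|P' r P'0 IH] v Sv.
  by rewrite pactC => /eqP; rewrite scaler_eq0 (negbTE c0) => /eqP.
rewrite pactM pact_XsubC => /IH H; apply: (finj (c := r)) => //.
by apply/eqP; rewrite -subr_eq0 H //; apply: subspaceB => //; [exact: fS|exact: subspaceZ].
Qed.

Lemma pact_surj P v : P != 0 -> S v -> exists2 w, S w & pact f P w = v.
Proof.
move=> P0; move: P P0 v.
apply: (split_ind (Q := fun P => forall v, S v -> exists2 w, S w & pact f P w = v)) =>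
  [c c0|P' r P'0 IH] v Sv.
  by exists (c^-1 *: v); rewrite ?pactC ?scalerA ?divff ?scale1r //; exact: subspaceZ.
have [w Sw <-] := IH v Sv; have [w' Sw' <-] := fsurj r Sw.
by exists w' => //; rewrite pactM pact_XsubC.
Qed.
Notation E := (sfield (fracs_closed ev)).

(** The action of [z = P(X)/Q(X)] on [v], as a relation: [Q(f)] is invertible only on [S], so [w] is
    characterised by an equation free of division. *)
Definition frac_act (z : L) (v w : V) := S w /\
  exists P Q, [/\ ev Q != 0, z * ev Q = ev P & pact f Q w = pact f P v].

Lemma ev_neq0_inv Q : ev Q != 0 -> Q != 0.
Proof. by apply: contraNneq => ->; rewrite rmorph0. Qed.

Lemma frac_act_uniq z v w w' : frac_act z v w -> frac_act z v w' -> w = w'.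
Proof.
move=> [Sw [P [Q [Q0 zQ Qw]]]] [Sw' [P' [Q' [Q'0 zQ' Qw']]]].
have PQ : P * Q' = P' * Q.
  by apply: ev_inj; rewrite !rmorphM -zQ -zQ' mulrAC.
apply/eqP; rewrite -subr_eq0; apply/eqP.
apply: (pact_inj (P := Q * Q')); first by apply: ev_neq0_inv; rewrite rmorphM mulf_neq0.
  exact: subspaceB.
have [g gE] := linear_bundle (pact_linear f (Q * Q')).
rewrite -gE linearB !gE pactM (mulrC Q) -pactM (mulrC Q') !pactM.
rewrite -(pactM f Q Q') mulrC pactM Qw -pactM mulrC PQ.
by rewrite (mulrC P') pactM -Qw' -pactM subrr.
Qed.

Lemma frac_act_ex (z : E) v : S v -> exists w, frac_act (val z) v w.
Proof.
move=> Sv; have [P [Q [Q0 zQ]]] := sfieldP z.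
have [w Sw Qw] := pact_surj (ev_neq0_inv Q0) (pactS P Sv).
by exists w; split=> //; exists P, Q.
Qed.

Lemma frac_act_lin c z z' v w w' : frac_act z v w -> frac_act z' v w' ->
  frac_act (j c * z + z') v (c *: w + w').
Proof.
move=> [Sw [P [Q [Q0 zQ Qw]]]] [Sw' [P' [Q' [Q'0 zQ' Qw']]]].
split; first by apply: subspaceD => //; exact: subspaceZ.
exists (c%:P * (P * Q') + P' * Q), (Q * Q'); split.
- by rewrite rmorphM mulf_neq0.
- by rewrite rmorphD !rmorphM evC -zQ -zQ'; ring.
have [g gE] := linear_bundle (pact_linear f (Q * Q')).
rewrite -gE linearP !gE pactD [in RHS]pactM pactC; congr (_ *: _ + _).
  by rewrite (mulrC Q) [LHS]pactM Qw -pactM (mulrC P).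
by rewrite [LHS]pactM Qw' -pactM (mulrC Q).
Qed.

Lemma frac_act_X z v w : frac_act z v w -> frac_act (z * X) v (f w).
Proof.
move=> [Sw [P [Q [Q0 zQ Qw]]]]; split; first exact: fS.
exists (P * 'X), Q; split=> //; first by rewrite mulrAC zQ rmorphM evX.
have fp R u : f (pact f R u) = pact f R (f u) by exact: pact_comm.
by rewrite pactMX -!fp Qw.
Qed.

(* [S] becomes a [k(X)]-vector space with [X] acting as [f]; the map is [l |-> eps l . v0]
   for a [k(X)]-linear functional [eps] on [L] with [eps 1 = 1]. *)
Lemma generic_map v0 : S v0 -> v0 != 0 -> exists g : MKt k L j V,
  [/\ forall l, S (val g l), forall l : L, f (val g l) = val g (l * X) &
      exists l, val g l != 0].
Proof.
move=> Sv0 v00.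
have [G GE] := choice (fun z : E => frac_act_ex z Sv0).
have [eps eps1] := MKt_functional (@sfval _ _ (fracs_closed ev)).
pose g (l : L) : V := G (eps l).
have eps_lin (e : E) (x y : L) : eps (val e * x + y) = e * eps x + eps y.
  exact: (linearP eps e x y).
have jE c : exists e : E, val e = j c.
  by apply: sfield_sub; rewrite -evC; exact: fracs_in.
have XE : exists e : E, val e = X by apply: sfield_sub; rewrite -evX; exact: fracs_in.
have Lg c x y : g (j c * x + y) = c *: g x + g y.
  have [e eE] := jE c.
  apply: (frac_act_uniq (z := val (eps (j c * x + y)))); first exact: GE.
  have -> : val (eps (j c * x + y)) = j c * val (eps x) + val (eps y).
    by rewrite -eE eps_lin rmorphD rmorphM.
  by apply: frac_act_lin; exact: GE.
have [h hE] := MKt_ex Lg.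
exists h; rewrite hE; split=> [l|l|] /=.
- by have [] := GE (eps l).
- have [e eE] := XE; apply: (frac_act_uniq (z := val (eps (l * X)))); last exact: GE.
  have -> : val (eps (l * X)) = val (eps l) * X.
    by rewrite mulrC -eE -[_ * l]addr0 eps_lin linear0 addr0 rmorphM mulrC.
  by apply: frac_act_X; exact: GE.
exists 1; rewrite /g eps1 (_ : G 1 = v0) //.
apply: (frac_act_uniq (z := 1)); first exact: GE.
split=> //; exists 1, 1; rewrite mul1r; split=> //.
by rewrite rmorph1 oner_eq0.
Qed.
End GenericMap.

(** * The rank two argument *)

(** The rank one criterion relative to a subspace; [N] will be the joint socle of the variables
    other than the two under study. *)
Definition exact_on (F : fieldType) (V : lmodType F) p (N : V -> Prop) (T : V -> V) :=
  forall x, N x -> T x = 0 -> exists2 y, N y & x = iter p.-1 T y.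

Section ExactOn.
Variables (F : fieldType) (V : lmodType F) (p : nat) (N : V -> Prop).
Hypotheses (p0 : (0 < p)%N) (sN : subspace N).
Variables (b T : {linear V -> V}).
Hypothesis (NT : forall x, N x -> N (T x)) (Nb : forall x, N x -> N (b x)).
Hypothesis eT : exact_on p N T.

Lemma iterN (f : V -> V) k x : (forall x, N x -> N (f x)) -> N x -> N (iter k f x).
Proof. by move=> Nf Nx; elim: k => //= k; exact: Nf. Qed.

(** Induction on [j] for [T^j x = 0]: since [T (T^(j-1) x) = 0], one has [T^(j-1) x = T^(p-1) y],
    and subtracting [T^(p-j) y] from [x] lowers [j]. *)
Lemma exact_on_swap x : (1 < p)%N -> N x -> iter p.-1 T x = 0 -> exists2 y, N y & x = T y.
Proof.
move=> p1 Nx.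
suff H j : (j <= p.-1)%N -> forall x, N x -> iter j T x = 0 -> exists2 y, N y & x = T y.
  exact: H.
elim: j => [|j IH] jp {Nx}x Nx /= Tx.
  by exists 0; rewrite ?linear0 //; case: sN.
have [y Ny xy] := eT (iterN _ NT Nx) Tx.
have [||z Nz xz] := IH (ltnW jp) (x - iter (p.-1 - j) T y).
- by apply: subspaceB => //; exact: iterN.
- by rewrite iter_linB -iterD subnKC ?(ltnW jp) // xy subrr.
exists (z + iter (p.-1 - j.+1) T y); first by apply: subspaceD => //; exact: iterN.
by rewrite linearD -xz -iterS subnSK // subrK.
Qed.

Hypothesis bT : forall x, b (T x) = T (b x).
Hypothesis (nb : forall x, iter p b x = 0).

(* Injectivity of the operator [y, z |-> T^(p-1) z] (where [b z = T y]) modulo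
   the image of [T^(p-1) b^(p-1)]. *)
Lemma bockstein_inj y z n : (1 < p)%N -> N y -> N z -> N n -> b z = T y ->
  iter p.-1 T z = iter p.-1 T (iter p.-1 b n) ->
  exists2 m, N m & iter p.-1 b y = iter p.-1 T (iter p.-1 b m).
Proof.
move=> p1 Ny Nz Nn bz Tz.
have [||w Nw zw] := exact_on_swap (x := z - iter p.-1 b n) p1.
- by apply: subspaceB => //; exact: iterN.
- by rewrite iter_linB Tz subrr.
have [||m Nm ym] := eT (x := y - b w).
- by apply: subspaceB => //; exact: Nb.
- by rewrite linearB -bz -bT -zw linearB -iterS prednK // nb subr0 subrr.
exists m => //; rewrite -iter_comm2 // -ym iter_linB -iterSr prednK // nb subr0.
by [].
Qed.
End ExactOn.

Section Core.
Variables (k L : fieldType) (j : {rmorphism k -> L}) (x : L) (p : nat).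
Hypotheses (pk : p \in [pchar k]) (kcl : is_closed k) (xj : forall c, j c != x).
Variables (V : lmodType k) (a b : {linear V -> V}) (N : V -> Prop).
Hypotheses (ab : forall v, a (b v) = b (a v)) (na : forall v, iter p a v = 0)
  (nb : forall v, iter p b v = 0).
Hypotheses (sN : subspace N) (Na : forall v, N v -> N (a v)) (Nb : forall v, N v -> N (b v)).
Hypothesis eb : exact_on p N b.
Hypothesis elam : forall lam, exact_on p N (fun v => a v - lam *: b v).
Let A : {linear MKt k L j V -> MKt k L j V} := MKop k L j V a.
Let B : {linear MKt k L j V -> MKt k L j V} := MKop k L j V b.
Let NL (g : MKt k L j V) := forall l, N (val g l).
Hypothesis ex : exact_on p NL (fun g => A g - x *: B g).

Let p_prime := pcharf_prime pk.
Let p1 : (1 < p)%N := prime_gt1 p_prime.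
Let p0 : (0 < p)%N := ltnW p1.

Let sigma n := iter p.-1 a (iter p.-1 b n).
Let soc v := [/\ N v, a v = 0 & b v = 0].
Let sigN v := exists2 n, N n & v = sigma n.

Lemma sigma_linear : linear sigma.
Proof. by move=> c u v; rewrite /sigma !iter_linear. Qed.

Lemma sigN_sub : subspace sigN.
Proof.
have [s sE] := linear_bundle sigma_linear; have [N0 Nlin] := sN.
split=> [|c u v [m Nm ->] [n Nn ->]]; first by exists 0; rewrite // -sE linear0.
by exists (c *: m + n); [exact: Nlin | rewrite -!sE linearP].
Qed.

Lemma soc_sub : subspace soc.
Proof.
have [N0 Nlin] := sN; split=> [|c u v [Nu au bu] [Nv av bv]].
  by split=> //; rewrite linear0.
by split; rewrite ?linearP ?au ?av ?bu ?bv ?scaler0 ?addr0 //; exact: Nlin.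
Qed.

Lemma sigN_soc v : sigN v -> soc v.
Proof.
move=> [n Nn ->]; split.
- by apply: iterN => //; exact: iterN.
- by rewrite /sigma -iterS prednK // na.
- by rewrite /sigma iter_comm // -iterS prednK // nb iter_lin0.
Qed.

Section Line.
Variable lam : k.

Lemma pencil_bundle : exists T : {linear V -> V}, forall v, T v = a v - lam *: b v.
Proof. by exists (a \- lam \*: b). Qed.

(* [bock v v'] says that [v'] represents the image of [v] under (Bockstein of [b])
   divided by (Bockstein of [a - lam b]) on the Tate cohomology [soc / sigma]. *)
Definition bock (v v' : V) := exists y z, [/\ N y, N z, b z = a y - lam *: b y,
  v = iter p.-1 b y & v' = iter p.-1 (fun v => a v - lam *: b v) z].

(** With [T = a - lam b], two choices satisfy [y - y1 = b w], hence [b] kills [z - z1 - T w], which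
    is therefore [b^(p-1) m]. Applying [T^(p-1)] leaves [sigma m]. *)
Lemma bock_uniq v v' w' : bock v v' -> bock v w' -> sigN (v' - w').
Proof.
have [T TE] := pencil_bundle.
have TF : (fun v => a v - lam *: b v) = T by apply: funext => u; rewrite TE.
have bT u : b (T u) = T (b u) by rewrite !TE linearB linearZ ab.
have NT u : N u -> N (T u).
  by move=> Nu; rewrite TE; apply: subspaceB; [|exact: Na|apply: subspaceZ => //; exact: Nb].
have nT u : iter p T u = 0 by exact: (pencil1_nil ab TE pk na nb).
rewrite /bock TF; move=> [y [z [Ny Nz bz vy ->]]] [y1 [z1 [Ny1 Nz1 bz1 vy1 ->]]].
have [||w Nw yw] := exact_on_swap sN Nb eb (x := y - y1) p1.
- exact: subspaceB.
- by rewrite iter_linB -vy -vy1 subrr.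
have [||m Nm zm] := eb (x := z - z1 - T w).
- by apply: subspaceB => //; [exact: subspaceB | exact: NT].
- by rewrite !linearB bz bz1 -!TE bT -yw -linearB subrr.
exists m => //; rewrite /sigma -(pencil1_socle ab TE pk nb) -zm !iter_linB -iterSr prednK //.
by rewrite nT subr0.
Qed.

Lemma bock_inj v v' : bock v v' -> sigN v' -> sigN v.
Proof.
have [T TE] := pencil_bundle.
have TF : (fun v => a v - lam *: b v) = T by apply: funext => u; rewrite TE.
have bT u : b (T u) = T (b u) by rewrite !TE linearB linearZ ab.
have NT u : N u -> N (T u).
  by move=> Nu; rewrite TE; apply: subspaceB; [|exact: Na|apply: subspaceZ => //; exact: Nb].
have eT : exact_on p N T by rewrite -TF; exact: elam.
rewrite /bock TF => -[y [z [Ny Nz bz -> ->]]] [n Nn Tz].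
rewrite /sigma -(pencil1_socle ab TE pk nb) in Tz.
have [|m Nm ym] := bockstein_inj p0 sN NT Nb eT bT nb p1 Ny Nz Nn _ Tz.
  by rewrite bz TE.
by exists m => //; rewrite ym (pencil1_socle ab TE pk nb).
Qed.

(** The construction of [bock] run backwards, with exactness for [T = a - lam b]: write
    [v' = T^(p-1) z]; then [T^(p-1)] kills [b z], so [b z = T y], and [b^(p-1) y] is the
    preimage. *)
Lemma bock_surj v' : soc v' -> exists2 v, soc v & bock v v'.
Proof.
have [T TE] := pencil_bundle.
have TF : (fun v => a v - lam *: b v) = T by apply: funext => u; rewrite TE.
have bT u : b (T u) = T (b u) by rewrite !TE linearB linearZ ab.
have NT u : N u -> N (T u).
  by move=> Nu; rewrite TE; apply: subspaceB; [|exact: Na|apply: subspaceZ => //; exact: Nb].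
have eT : exact_on p N T by rewrite -TF; exact: elam.
move=> [Nv av bv].
have [|z Nz vz] := eT _ Nv; first by rewrite TE av bv scaler0 subr0.
have [||y Ny bz] := exact_on_swap sN NT eT (x := b z) p1; first exact: Nb.
  by rewrite -iter_comm // -vz.
have bw : b (iter p.-1 b y) = 0 by rewrite -iterS prednK // nb.
exists (iter p.-1 b y).
  split=> //; first exact: iterN.
  have : T (iter p.-1 b y) = 0.
    by rewrite iter_comm // -bz -iterSr prednK // nb.
  by rewrite TE bw scaler0 subr0.
by exists y, z; rewrite TF vz bz -TE.
Qed.
End Line.

Lemma MKop_val n (T : {linear V -> V}) (g : MKt k L j V) l :
  val (iter n (MKop k L j V T) g) l = iter n T (val g l).
Proof. by elim: n => //= n ->. Qed.

Lemma root_pth (c : k) : exists lam : k, lam ^+ p = c.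
Proof.
have [|lam] := kcl (q := 'X^p - c%:P); first by rewrite size_XnsubC // eqSS -lt0n.
by rewrite /root !hornerE subr_eq0 => /eqP; exists lam.
Qed.

Lemma core v : N v -> a v = 0 -> b v = 0 -> sigN v.
Proof.
move=> Nv av bv; have sv : soc v by [].
have [[N0 _] [sN0 _]] := (sN, sigN_sub).
have [bq bqE] := linear_bundle (iter_linear _ _ b p.-1).
have [sg sgE] := linear_bundle sigma_linear.
have [Bm [NBm BmE]] := linear_section bq sN.
have [bm [Nbm bmE]] := linear_section b sN.
have [sm [Nsm smE]] := linear_section sg sN.
have [f0 f0E] := linear_bundle (iter_linear _ _ a p.-1).
(* The operator [a^(p-1) b^(-1) a b^(-(p-1))], the inverses being chosen linear sections: a linear
   choice for [bock 0] on the socle. *)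
have {f0 f0E} [f0 f0E] : exists f0 : {linear V -> V},
    forall u, f0 u = iter p.-1 a (bm (a (Bm u))).
  by exists (f0 \o (bm \o (a \o Bm))) => u; rewrite /= f0E.
pose e : {linear V -> V} := sg \o sm.
have eN u : sigN (e u) by exists (sm u); rewrite //= sgE.
have e_id u : sigN u -> e u = u by move=> [n Nn ->]; rewrite /= -sgE smE.
have Bm_soc u : soc u -> iter p.-1 b (Bm u) = u.
  by move=> [Nu au bu]; have [y Ny uy] := eb Nu bu; rewrite uy -!bqE BmE.
have bm_soc u : soc u -> b (bm (a (Bm u))) = a (Bm u).
  move=> su; have [Nu au bu] := su.
  have [||z Nz ->] := exact_on_swap sN Nb eb (x := a (Bm u)) p1; last exact: bmE.
    exact: Na.
  by rewrite -iter_comm // Bm_soc.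
(* One [f0] serves every [lam]: keeping [y] and replacing [z] by [z - lam y] subtracts [lam^p u]. *)
have f0_bock lam u : soc u -> bock lam u (f0 u - lam ^+ p *: u).
  move=> su; have [T TE] := pencil_bundle lam.
  have TF : (fun v => a v - lam *: b v) = T by apply: funext => w; rewrite TE.
  exists (Bm u), (bm (a (Bm u)) - lam *: Bm u); split.
  - exact: NBm.
  - by apply: subspaceB => //; exact: subspaceZ.
  - by rewrite linearB linearZ bm_soc.
  - by rewrite Bm_soc.
  by rewrite TF (pencil1_bockstein ab TE pk (bm_soc _ su)) f0E Bm_soc.
have f0_soc u : soc u -> soc (f0 u).
  move=> su; rewrite f0E; split; first exact: iterN.
    by rewrite -iterS prednK // na.
  by rewrite iter_comm // bm_soc // -iterSr prednK // na.
have f0_sig u : sigN u -> sigN (f0 u).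
  move=> su; have [n Nn un] := su; have := f0_bock 0 u (sigN_soc su).
  rewrite expr0n eqn0Ngt p0 scale0r subr0 => H.
  have -> : f0 u = f0 u - 0 by rewrite subr0.
  (* As [u = b^(p-1) (a^(p-1) n)] and [a] kills [a^(p-1) n], one may take [z = 0]: the class of [u]
     goes to 0. *)
  apply: (bock_uniq H); exists (iter p.-1 a n), 0; split=> //.
  - exact: iterN.
  - by rewrite linear0 scale0r subr0 -iterS prednK // na.
  - by rewrite un /sigma iter_comm2.
  have [T TE] := pencil_bundle 0.
  have -> : (fun v => a v - 0 *: b v) = T by apply: funext => w; rewrite TE.
  by rewrite iter_lin0.
(* [e] is the identity on [sigN] and has values there, so [S] is a complement of [sigN] in the socle
   and stands for the quotient; [F] below is [f0] compressed to it. *)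
pose S u := soc u /\ e u = 0.
have sS : subspace S.
  have [soc0 soclin] := soc_sub.
  split=> [|c u w [su eu] [sw ew]]; first by split=> //; rewrite linear0.
  by split; [exact: soclin | rewrite linearP eu ew scaler0 addr0].
have eS u : soc u -> S (u - e u).
  move=> su; split; last by rewrite linearB [e (e u)]e_id // subrr.
  by apply: (subspaceB soc_sub) => //; exact: sigN_soc.
pose F : {linear V -> V} := f0 \- (e \o f0).
have FS u : S u -> S (F u) by move=> [su _]; apply: eS; exact: f0_soc.
have Finj c u : S u -> F u = c *: u -> u = 0.
  move=> [su eu] Fu; have [lam lamc] := root_pth c.
  rewrite -eu e_id //; apply: (bock_inj (f0_bock lam u su)).
  have -> : f0 u - lam ^+ p *: u = e (f0 u) by rewrite lamc -Fu /= opprB addrC subrK.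
  exact: eN.
have Fsurj c u : S u -> exists2 w, S w & F w - c *: w = u.
  move=> [su eu]; have [lam lamc] := root_pth c.
  have [w sw wu] := bock_surj lam su; exists (w - e w); first exact: eS.
  set w' := w - e w; apply/eqP; rewrite -subr_eq0; apply/eqP.
  have Sw' : S w' by exact: eS.
  have SD : S (F w' - c *: w' - u).
    apply: subspaceB => //; apply: subspaceB => //; first exact: FS.
    exact: subspaceZ.
  have [_ <-] := SD; rewrite e_id //.
  have H := bock_uniq (f0_bock lam w sw) wu; rewrite lamc in H.
  have -> : F w' - c *: w' - u =
      (f0 w - c *: w - u) - (f0 (e w) - c *: e w) - e (f0 w').
    have fw : f0 w' = f0 w - f0 (e w) by rewrite linearB.
    have cw : c *: w' = c *: w - c *: e w by rewrite scalerBr.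
    rewrite -[F w']/(f0 w' - e (f0 w')) cw; move: (e (f0 w')) => q5; rewrite fw.
    move: (f0 w) (f0 (e w)) (c *: w) (c *: e w) => q1 q2 q3 q4.
    by rewrite !opprB [LHS](AC (3*2*1) ((1*5*6)*(4*2)*3)).
  apply: (subspaceB sigN_sub) => //; apply: (subspaceB sigN_sub) => //.
  apply: (subspaceB sigN_sub); first exact: f0_sig.
  exact: (subspaceZ _ sigN_sub).
have [v0|v0] := eqVneq (v - e v) 0.
  by move/eqP: v0; rewrite subr_eq0 => /eqP ->.
exfalso; have Sv0 := eS v sv; set v0' := v - e v in v0 Sv0.
have pL : p \in [pchar L] by rewrite (fmorph_pchar j).
have Xtr c : j c != x ^+ p.
  have [lam <-] := root_pth c; apply/eqP => E; case/eqP: (xj lam); apply/eqP.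
  have : (j lam - x) ^+ p == 0.
    by rewrite -(pFrobenius_autE pL) pFrobenius_autB_comm ?pFrobenius_autE -?rmorphXn ?E ?subrr //; exact: mulrC.
  by rewrite expf_eq0 => /andP[_]; rewrite subr_eq0.
have [g [gS gF [l gl]]] := generic_map kcl Xtr sS FS Finj Fsurj Sv0 v0.
(* [S] meets [sigN] only in 0, so it remains to place the values of [g] in [sigN]. This is done for
   [g] as a whole, by exactness at [x]. *)
case/eqP: gl; have [sgl <-] := gS l; rewrite e_id //.
pose Op := MKop k L j V.
pose Y := Op Bm g; pose Z := Op bm (A Y).
have [T TE] : exists T : {linear MKt k L j V -> MKt k L j V}, forall h, T h = A h - x *: B h.
  by exists (A \- x \*: B).
have AB h : A (B h) = B (A h) by apply: MKt_ext => z /=; rewrite ab.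
have nA h : iter p A h = 0 by apply: MKt_ext => z; rewrite MKop_val na.
have nB h : iter p B h = 0 by apply: MKt_ext => z; rewrite MKop_val nb.
have sNL : subspace NL.
  split=> [z|c h h' Nh Nh' z]; first exact: N0.
  exact: (subspaceD sN (Nh _) (Nh' z)).
have NLA h : NL h -> NL (A h) by move=> Nh z; exact: Na.
have NLB h : NL h -> NL (B h) by move=> Nh z; exact: Nb.
have NLT h : NL h -> NL (T h).
  move=> Nh; rewrite TE.
  exact: (subspaceB sNL (NLA _ Nh) (subspaceZ x sNL (NLB _ Nh))).
have BT h : B (T h) = T (B h) by rewrite !TE linearB linearZ AB.
have eT : exact_on p NL T by rewrite (_ : (T : _ -> _) = fun g => A g - x *: B g) //; exact: funext.
have NY : NL Y by move=> z; exact: NBm.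
have NZ : NL Z by move=> z; exact: Nbm.
have BZ : B Z = A Y.
  by apply: MKt_ext => z; apply: bm_soc; have [] := gS z.
have BY : iter p.-1 B Y = g.
  by apply: MKt_ext => z; rewrite MKop_val; apply: Bm_soc; have [] := gS z.
(* The scalar multiple [x^p g] is [l |-> g (l x^p) = F (g l)], so [A^(p-1) Z - x^p g] is
   [f0 g - F g = e (f0 g)], that is, [sigma] of [sm (f0 g)]. *)
pose n := Op (sm \o f0) g.
have [||||m Nm gm] := bockstein_inj p0 sNL NLT NLB eT BT nB (y := Y) (z := Z - x *: Y) (n := n) p1 NY.
- exact: (subspaceB sNL NZ (subspaceZ x sNL NY)).
- by move=> z; exact: Nsm.
- by rewrite linearB linearZ BZ TE.
- rewrite (pencil1_bockstein AB TE pL BZ) (pencil1_socle AB TE pL nB) BY.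
  apply: MKt_ext => z; rewrite !MKop_val.
  have -> : val (iter p.-1 A Z - x ^+ p *: g) z =
      val (iter p.-1 A Z) z - val g ((z : L) * x ^+ p) by [].
  rewrite MKop_val -gF -f0E /= opprB addrC subrK.
  by rewrite sgE.
exists (val m l); first exact: Nm.
by rewrite -BY gm (pencil1_socle AB TE pL nB) !MKop_val.
Qed.
End Core.

(** * Towers of algebraically closed fields *)

(** A chain of [n] proper extensions of algebraically closed fields, all mapped compatibly into [K].
    Properness is recorded by one new element per step, the generic slope of a hyperplane. *)
Inductive tower (K : fieldType) :
    forall L : fieldType, {rmorphism L -> K} -> nat -> Prop :=
| Tower0 (L : fieldType) (i : {rmorphism L -> K}) : is_closed L -> tower i 0
| TowerS (L L' : fieldType) (i : {rmorphism L -> K}) (i' : {rmorphism L' -> K})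
    (j : {rmorphism L -> L'}) (x : L') (n : nat) :
    is_closed L -> (forall z, i' (j z) = i z) -> (forall c, j c != x) ->
    tower i' n -> tower i n.+1.

Lemma tower_closed (K L : fieldType) (i : {rmorphism L -> K}) n :
  tower i n -> is_closed L.
Proof. by case. Qed.

Lemma towerSP (K L : fieldType) (i : {rmorphism L -> K}) n : tower i n.+1 ->
  exists (L' : fieldType) (i' : {rmorphism L' -> K}) (j : {rmorphism L -> L'}) (x : L'),
    [/\ forall z, i' (j z) = i z, forall c, j c != x & tower i' n].
Proof.
move: {-2}(n.+1) (erefl n.+1) => m E T.
by case: T E => // {}L L' {}i i' j x m' _ ij xj T [<-]; exists L', i', j, x.
Qed.

(** The induction on the rank also revisits the bottom field, with one variable fewer; there the top
    extension is dropped. *)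
Lemma tower_pred (K L : fieldType) (i : {rmorphism L -> K}) n : tower i n.+1 -> tower i n.
Proof.
elim: n L i => [|n IH] L i T; first exact: Tower0 (tower_closed T).
have [L' [i' [j [x [ij xj /IH T']]]]] := towerSP T.
exact: (TowerS (tower_closed T) ij xj T').
Qed.

Section AlgClosure.
Variables (D : idomainType) (K : closedFieldType) (e : {rmorphism D -> K}).
Notation FD := (sfield (fracs_closed e)).

(** Algebraicity over the fraction field of the image of [D]; [D] will be a polynomial ring over
    [k]. *)
Definition alg_over (z : K) := algebraicOver (@sfval _ _ (fracs_closed e)) z.

Lemma alg_over_closed : subfield_closed alg_over.
Proof.
split; first exact: algebraic1.
  by move=> x y; exact: algebraic_sub.
by move=> x y; exact: algebraic_div.
Qed.

Definition algK := sfield alg_over_closed.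

Lemma alg_over_in P : alg_over (e P).
Proof.
have [z <-] := sfield_sub (fracs_closed e) (fracs_in e P).
exact: algebraic_id.
Qed.

Lemma algK_is_closed : is_closed algK.
Proof.
move=> q q1; have [->|q0] := eqVneq q 0; first by exists 0; rewrite root0.
have [|z qz] := @closed_rootP K (map_poly val q) _; first by rewrite size_map_poly.
have az : alg_over z.
  apply/integral_algebraic/(integral_root _ qz); first by rewrite map_poly_eq0.
  move=> c /(nthP 0)[n _ <-]; rewrite coef_map.
  exact/integral_algebraic/(sfieldP q`_n).
have [w wz] := sfield_sub alg_over_closed az.
by exists w; rewrite -(fmorph_root (@sfval _ _ alg_over_closed)) /= wz.
Qed.

Lemma common_denom (F0 : fieldType) (s : {rmorphism F0 -> K}) (p : {poly F0}) :
  (forall c, fracs e (s c)) -> exists (d : D) (P : {poly D}),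
  e d != 0 /\ map_poly e P = e d *: map_poly s p.
Proof.
move=> sE; elim/poly_ind: p => [|p c [d [P [d0 PE]]]].
  by exists 1, 0; rewrite !rmorph0 scaler0 rmorph1 oner_eq0.
have [A [B [B0 cB]]] := sE c.
exists (d * B), (B *: P * 'X + (d * A)%:P); rewrite rmorphM mulf_neq0 //.
split=> //; rewrite !rmorphD !rmorphM /= map_polyZ !map_polyX PE !map_polyC /= ?map_polyX.
by rewrite -cB -!mul_polyC !polyCM; ring.
Qed.

Lemma alg_over_poly z : alg_over z -> exists2 P : {poly D}, P != 0 & root (map_poly e P) z.
Proof.
move=> [p p0 pz]; have [d [P [d0 PE]]] := common_denom (s := sfval _) p (@sfieldP _ _ (fracs_closed e)).
exists P; last by rewrite PE rootZ.
apply: contraNneq p0 => P0; move/eqP: PE; rewrite P0 rmorph0 eq_sym.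
by rewrite scaler_eq0 (negbTE d0) map_poly_eq0.
Qed.
End AlgClosure.

Lemma alg_over_mono (D D' : idomainType) (K : closedFieldType)
    (e : {rmorphism D -> K}) (e' : {rmorphism D' -> K}) (f : D -> D') :
  (forall P, e' (f P) = e P) -> forall z, alg_over e z -> alg_over e' z.
Proof.
move=> fE z [p p0 pz].
have sub (w : sfield (fracs_closed e)) : fracs e' (sfval _ w).
  by have [P [Q [Q0 wQ]]] := sfieldP w; exists (f P), (f Q); rewrite !fE.
have [g gE] := sfield_lift (fracs_closed e') sub.
exists (map_poly g p); first by rewrite map_poly_eq0.
rewrite -map_poly_comp (_ : map_poly _ p = map_poly (sfval (fracs_closed e)) p) //.
by apply: eq_map_poly => w; exact: gE.
Qed.

Section TowerOfIndep.
Variables (k : fieldType) (K : closedFieldType) (iota : {rmorphism k -> K}) (x : nat -> K).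

Definition evx n : {rmorphism {mpoly k[n]} -> K} :=
  meval (fun i : 'I_n => x i) \o map_mpoly iota.

Arguments evx : simpl never.

Lemma evxC n c : evx n c%:MP = iota c.
Proof. by rewrite /evx /= map_mpolyC mevalC. Qed.

Lemma evxE n P : evx n P = \sum_(m <- msupp P) iota P@_m * \prod_(i < n) x i ^+ m i.
Proof.
rewrite {1}[P]mpolyE raddf_sum; apply: eq_bigr => m _.
by rewrite /evx /= map_mpolyZ mevalZ map_mpolyX mevalX.
Qed.

Lemma evx_X n : evx n.+1 'X_ord_max = x n.
Proof. by rewrite /evx /= map_mpolyX mevalXU. Qed.

Lemma mwiden_sum n (P : {mpoly k[n]}) :
  mwiden P = \sum_(m <- msupp P) P@_m *: 'X_[mnmwiden m].
Proof.
rewrite {1}[P]mpolyE raddf_sum; apply: eq_bigr => m _ /=.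
by rewrite mwidenZ mwidenX.
Qed.

Lemma evx_widen n P : evx n.+1 (mwiden P) = evx n P.
Proof.
rewrite mwiden_sum raddf_sum evxE; apply: eq_bigr => m _.
rewrite /evx /= map_mpolyZ mevalZ map_mpolyX mevalX big_ord_recr /=.
rewrite mnmwiden_ordmax expr0 mulr1; congr (_ * _); apply: eq_bigr => i _.
by rewrite mnmwiden_widen.
Qed.

Lemma muni_X n (m : 'X_{1..n.+1}) : muni 'X_[k, m] =
  'X_[k, [multinom (m (widen_ord (leqnSn n) i)) | i < n]] *: 'X^(m ord_max).
Proof. by rewrite muniE msuppX big_seq1 mcoeffX eqxx scale1r. Qed.

Lemma muni_widen n (P : {mpoly k[n]}) : muni (mwiden P) = P%:P.
Proof.
rewrite mwiden_sum raddf_sum {3}[P]mpolyE rmorph_sum; apply: eq_bigr => m _ /=.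
rewrite muniZ muni_X mnmwiden_ordmax expr0 alg_polyC -mul_polyC -polyCM mul_mpolyC.
congr ((_ *: 'X_[_])%:P); apply/mnmP => i; by rewrite mnmE mnmwiden_widen.
Qed.

(** A polynomial in [x n] over [k[x_0, ..., x_(n-1)]] is a polynomial in one more variable. It stays
    nonzero because [muni] recovers [P] from it. *)
Lemma evx_next n (P : {poly {mpoly k[n]}}) : P != 0 ->
  exists2 Q : {mpoly k[n.+1]}, Q != 0 & evx n.+1 Q = (map_poly (evx n) P).[x n].
Proof.
move=> P0; pose Q := \sum_(i < size P) mwiden P`_i * 'X_ord_max ^+ i.
have uX : muni ('X_ord_max : {mpoly k[n.+1]}) = 'X.
  rewrite muni_X mnm1E eqxx expr1 (_ : [multinom _ | _ < _] = 0%MM) ?mpolyX0 ?scale1r //.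
  apply/mnmP => i; rewrite mnmE mnm0E mnm1E; apply/eqP; rewrite eqb0 -val_eqE /=.
  by rewrite gtn_eqF.
exists Q.
  apply: contraNneq P0 => Q0; rewrite -[P]coefK poly_def.
  have -> : \sum_(i < size P) P`_i *: 'X^i = muni Q; last by rewrite Q0 rmorph0.
  rewrite [RHS]rmorph_sum; apply: eq_bigr => i _ /=.
  by rewrite [RHS]rmorphM rmorphXn /= muni_widen uX mul_polyC.
rewrite (horner_coef_wide _ (size_poly _ _)) rmorph_sum; apply: eq_bigr => i _.
rewrite rmorphM rmorphXn coef_poly ltn_ord.
by congr (_ * _ ^+ _); [exact: evx_widen | exact: evx_X].
Qed.

Definition indep n := forall P : {mpoly k[n]}, P != 0 -> evx n P != 0.

Lemma indep_pred n : indep n.+1 -> indep n.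
Proof.
move=> H P P0; rewrite -evx_widen; apply: H.
by apply: contraNneq P0 => E; apply/eqP/inj_mwiden; rewrite E mwiden0.
Qed.

Lemma indep_le m n : (m <= n)%N -> indep n -> indep m.
Proof.
move=> /subnK <-; elim: (n - m)%N => // d IH /indep_pred; exact: IH.
Qed.

Lemma indep_not_alg n : indep n.+1 -> ~ alg_over (evx n) (x n).
Proof.
move=> H /alg_over_poly[P P0 /rootP Px]; have [Q Q0 Qx] := evx_next P0.
by have := H Q Q0; rewrite Qx Px eqxx.
Qed.

(** The step passes from the algebraic closure in [K] of [k(x_0, ..., x_(n-1))] to that of
    [k(x_0, ..., x_n)]; the new element is [x n]. *)
Lemma tower_of_indep n d : indep (n + d) ->
  tower (sfval (alg_over_closed (evx n))) d.
Proof.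
elim: d n => [|d IH] n H; first by apply: Tower0; exact: algK_is_closed.
have sub (w : algK (evx n)) : alg_over (evx n.+1) (sfval _ w).
  exact: (alg_over_mono (@evx_widen n) (sfieldP w)).
have [g gE] := sfield_lift (alg_over_closed (evx n.+1)) sub.
have xin : alg_over (evx n.+1) (x n).
  by rewrite -evx_X; exact: alg_over_in.
have [y yx] := sfield_sub (alg_over_closed (evx n.+1)) xin.
apply: (@TowerS _ _ _ _ (sfval (alg_over_closed (evx n.+1))) g y) => //.
- exact: algK_is_closed.
- move=> c; apply/eqP => cy.
  apply: (@indep_not_alg n); first by apply: indep_le H; rewrite addnS ltnS leq_addr.
  by rewrite -yx -cy gE; exact: sfieldP.
by apply: IH; rewrite addSnnS.
Qed.
End TowerOfIndep.

Lemma trdeg_tower (k : fieldType) (K : closedFieldType) (iota : {rmorphism k -> K}) n :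
  trdeg_ge iota n -> exists (L : fieldType) (i : {rmorphism L -> K}) (j : {rmorphism k -> L}),
    (forall z, i (j z) = iota z) /\ tower i n.
Proof.
move=> [x xi]; pose y l := if insub l is Some i then x i else 0.
have ind : indep iota y n.
  move=> P /xi; rewrite /evx /= (meval_eq (v2 := x)) // => i.
  by rewrite /y valK.
have T := @tower_of_indep k K iota y 0 n ind.
have sub (c : k) : alg_over (evx iota y 0) (iota c).
  by rewrite -(evxC iota y 0); exact: alg_over_in.
have [g gE] := sfield_lift (alg_over_closed (evx iota y 0)) sub.
by exists (algK (evx iota y 0)), (sfval _), g.
Qed.

(** * Change of field and of variables *)

Section ExactTransfer.
Variables (F : fieldType) (r p : nat).

Lemma eq_exact (M : tmod F r) (t : 'I_r -> {linear M -> M}) :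
  (forall i y, t i y = top M i y) -> exact p (@TMod F r M t) <-> exact p M.
Proof.
move=> H; split=> e x kx.
  have [|y ->] := e x; first by move=> i /=; rewrite H.
  by exists y; rewrite (@eq_sig _ p _ M t y H).
have [|y ->] := e x; first by move=> i; rewrite -H; exact: kx.
by exists y; rewrite (@eq_sig _ p _ M t y H).
Qed.

End ExactTransfer.

Section Hyperplanes.
Variables (F : fieldType) (p : nat).
Hypothesis pF : p \in [pchar F].
Let p0 : (0 < p)%N := prime_gt0 (pcharf_prime pF).

Lemma exact_tcons r (N : tmod F r.+1) :
  exact p N <-> exact p (tcons (M := tail N) (top N ord0)).
Proof.
suff H i y : top (tcons (M := tail N) (top N ord0)) i y = top N i y.
  exact: iff_sym (@eq_exact F r.+1 p N (top (tcons (M := tail N) (top N ord0))) H).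
by case: (unliftP ord0 i) => [j|] ->; rewrite ?tconsS ?tcons0.
Qed.

Lemma exact_tail r (N : tmod F r.+1) : tmod_ax p N -> exact p N -> exact p (tail N).
Proof.
move=> aN /exact_tcons e; have [cN nN] := aN.
exact: (exact_tcons_tl p0 (tail_ax aN) (nN ord0) (fun i x => cN _ _ _) e).
Qed.

(** A joint socle vector is [T^(p-1) (sigma y)], and [sigma y] already lies in the socle of [M]. *)
Lemma exact_on_tcons r (M : tmod F r) (T : {linear M -> M}) : tmod_ax p M ->
  exact p (tcons T) -> exact_on p (fun x => forall i, top M i x = 0) T.
Proof.
move=> aM e x kx Tx; have [|y ->] := e x; first exact/tcons_kill.
by exists (sig p (y : M)); [move=> i; exact: sig_kill | rewrite sig_tcons].
Qed.

Definition hyp r (lam : F) (N : tmod F r.+2) : tmod F r.+1 :=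
  tcons (M := tail (tail N)) (top N ord0 \- lam \*: top N (lift ord0 ord0)).

Variables (r : nat) (lam : F) (N : tmod F r.+2).
Hypothesis aN : tmod_ax p N.
Let a := top N ord0.
Let b := top N (lift ord0 ord0).
Let T : {linear N -> N} := a \- lam \*: b.
Let TE x : T x = a x - lam *: b x. Proof. by []. Qed.
Let ab x : a (b x) = b (a x). Proof. by have [cN _] := aN; exact: cN. Qed.
Let na x : iter p a x = 0. Proof. by have [_ nN] := aN; exact: nN. Qed.
Let nb x : iter p b x = 0. Proof. by have [_ nN] := aN; exact: nN. Qed.

Lemma hyp_ax : tmod_ax p (hyp lam N).
Proof.
have [cN _] := aN; apply: tcons_ax.
- exact/tail_ax/tail_ax.
- exact: (pencil1_nil ab TE pF na nb).
move=> i x; rewrite /= [RHS]linearB [in RHS]linearZ /=.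
by congr (_ - _ *: _); exact: cN.
Qed.

(** Adjoining [b] to the hyperplane operators gives back the same algebra and, by [pencil1_socle],
    the same [sigma]; then [exact_tcons_tl] removes [b] again. *)
Lemma exact_hyp : exact p N -> exact p (hyp lam N).
Proof.
have [cN _] := aN; move=> eN.
refine (@exact_tcons_tl _ _ p0 _ (hyp lam N) b hyp_ax nb _ _).
  move=> i x; case: (unliftP ord0 i) => [i'|] ->; rewrite ?tconsS ?tcons0 /=.
    exact: cN.
  by rewrite linearB linearZ /= -/a -/b ab.
move=> x /tcons_kill[bx /tcons_kill[ax kx]]; have [|y ->] := eN x.
  move=> i; case: (unliftP ord0 i) => [i'|] ->.
    by case: (unliftP ord0 i') => [i''|] ->; [exact: kx | exact: bx].
  by move: ax; rewrite /= bx scaler0 subr0.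
exists y; rewrite !sig_tcons sig_tail (sig_tail p (N := tail N)) -/a.
rewrite -[top (tail N) ord0]/b -(pencil1_socle ab TE pF nb) iter_comm2 //.
by move=> z; rewrite !TE [RHS]linearB [in RHS]linearZ /= ab.
Qed.
End Hyperplanes.

(** * Coinduced modules and the detection hypothesis *)

Section MKLemmas.
Variables (k K : fieldType) (i : {rmorphism k -> K}) (r p : nat) (M : tmod k r).

Lemma MK_ax : tmod_ax p M -> tmod_ax p (MK i M).
Proof.
move=> [cM nM]; split=> [l m f|l f]; apply: MKt_ext => z /=; first exact: cM.
by rewrite -[RHS](nM l (val f z)); elim: (p) => //= q ->.
Qed.

Lemma MK_sig (f : MK i M) z : val (sig p f) z = sig p (val f z) :> M.
Proof.
rewrite /sig; elim: (enum _) => //= l s <-.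
by elim: (p.-1) => //= q ->.
Qed.

(** Ascent composes with a linear section of [sigma]. Descent uses a functional [eps] with
    [eps 1 = 1]: a socle vector [x] becomes the map [z |-> eps z x], and the answer is evaluated at
    1. *)
Lemma MK_exact : exact p M <-> exact p (MK i M).
Proof.
split=> e x kx.
  have [s sE] := linear_bundle (@sig_linear _ _ p M).
  have [s' [_ s'E]] := linear_section s (@subspaceT _ _).
  exists (MKop k K i M s' x); apply: MKt_ext => z; rewrite MK_sig /=.
  have [|y xy] := e (val x z).
    by move=> l; have /(congr1 (fun f : MKt k K i M => val f z)) := kx l.
  by rewrite xy -!sE s'E.
have [eps eps1] := MKt_functional i.
have [|X XE] := @MKt_ex k K i M (fun z => eps z *: x).
  move=> a y z; have -> : eps (i a * y + z) = a * eps y + eps z by exact: (linearP eps a y z).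
  by rewrite scalerDl scalerA.
have [|Y XY] := e X.
  by move=> l; apply: MKt_ext => z /=; rewrite XE linearZ /= kx scaler0.
exists (val Y (1 : K)); rewrite -MK_sig -XY XE.
by rewrite eps1 scale1r.
Qed.
End MKLemmas.

Definition detects (k K : fieldType) (i : {rmorphism k -> K}) r p (M : tmod k r) :=
  forall u : RKel K r p, (forall m, powRK K r p u p m = 0) -> flat_alpha u ->
    exact p (restrict (MK i M) u).

Section Coefficients.
Variables (K : fieldType) (r p : nat).
Hypothesis p1 : (1 < p)%N.
Let p0 : (0 < p)%N := ltnW p1.
Notation FK := (FreeK K r p).

Lemma powRK_eq0 (u : RKel K r p) : (forall x : FK, iter p (act FK u) x = 0) ->
  forall m, powRK K r p u p m = 0.
Proof.
move=> Hu m; suff H n : powRK K r p u n =1 ofFree (iter n (act FK u) (single r p0 (1 : K^o))).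
  by rewrite H Hu /ofFree ffunE.
elim: n => [|n IH] {}m /=; first exact: oneRKE.
rewrite /powRK /= -/(powRK K r p u n) mulRKE; congr (ofFree (act FK u _) m).
by apply/ffunP => m'; rewrite ffunE IH.
Qed.

(* An algebra map [R'_K -> R_K], given by operators natural in the module, sends a flat
   [alpha'] to a flat [alpha] as soon as [R_K] is free over [R'_K]. *)
Lemma substitution s (T : forall N : tmod K r, 'I_s -> {linear N -> N}) (u' : RKel K s p) :
  (forall (N N' : tmod K r) (g : {linear N -> N'}), tmorph g ->
     forall l x, g (T N l x) = T N' l (g x)) ->
  tmod_ax p (@TMod K s FK (T FK)) -> exact p (@TMod K s FK (T FK)) ->
  (forall m, powRK K s p u' p m = 0) -> flat_alpha u' ->
  exists u : RKel K r p, [/\ forall m, powRK K r p u p m = 0, flat_alpha u &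
    forall N : tmod K r, tmod_ax p N -> act N u =1 act (@TMod K s N (T N)) u'].
Proof.
move=> Tnat aT eT u0 fl; set CF := @TMod K s FK (T FK) in aT eT.
pose u := ofFree (act CF u' (single r p0 (1 : K^o) : FK)).
have actE (N : tmod K r) : tmod_ax p N -> act N u =1 act (@TMod K s N (T N)) u'.
  move=> aN x; have [ev [evm evE]] := act_ev aN x.
  have evC : @tmorph K s CF (@TMod K s N (T N)) ev by move=> l y; exact: Tnat.
  by rewrite -evE (tmorph_act u' _ evC) evE act_single.
have itE n x : iter n (act FK u) x = iter n (act CF u') x.
  by elim: n => //= n ->; exact: (actE FK (Free_ax r p K^o) _).
have u_nil : forall m, powRK K r p u p m = 0.
  by apply: powRK_eq0 => x; rewrite itE; exact: (act_pow0 p0 aT).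
exists u; split=> //; apply: (exact_flat_alpha p1 u_nil).
have /exact1P eu' := exact_flat p1 aT eT u0 fl.
apply/exact1P => x /= ux; have [|y xy] := eu' x.
  by rewrite -ux; symmetry; exact: (actE FK (Free_ax r p K^o) _).
by exists y; rewrite itE.
Qed.

End Coefficients.

(** For [r = 1] the identity of [K[t]/(t^p)] is an admissible [alpha]; this starts the induction on
    the rank. *)
Lemma variable_flat (K : fieldType) p : (1 < p)%N -> exists u : RKel K 1 p,
  [/\ forall m, powRK K 1 p u p m = 0, flat_alpha u &
    forall N : tmod K 1, tmod_ax p N -> act N u =1 top N ord0].
Proof.
move=> p1; have p0 : (0 < p)%N := ltnW p1; pose FK := FreeK K 1 p.
pose u := ofFree (top FK ord0 (single 1 p0 (1 : K^o))).
have actE (N : tmod K 1) : tmod_ax p N -> act N u =1 top N ord0.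
  move=> aN x; have [ev [evm evE]] := act_ev aN x.
  by rewrite -evE evm evE act_single.
have itE n x : iter n (act FK u) x = iter n (top FK ord0) x.
  by elim: n => //= n ->; exact: (actE FK (Free_ax 1 p K^o) _).
have u_nil : forall m, powRK K 1 p u p m = 0.
  by apply: (powRK_eq0 p1) => x; rewrite itE; have [_ H] := Free_ax 1 p K^o; exact: H.
exists u; split=> //; apply: (exact_flat_alpha p1 u_nil).
have /exact1P eF := @Free_exact K 1 p K^o p0.
apply/exact1P => x /= ux; have [|y xy] := eF x.
  by rewrite -ux; symmetry; exact: (actE FK (Free_ax 1 p K^o) _).
by exists y; rewrite itE.
Qed.

Section Transfer.
Variables (L L' K : fieldType) (i : {rmorphism L -> K}) (i' : {rmorphism L' -> K}).
Variable j : {rmorphism L -> L'}.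
Hypothesis ij : forall z, i' (j z) = i z.
Variables (V : lmodType L).

(** Evaluation at 1 identifies [Hom_L'(K, Hom_L(L', V))] with [Hom_L(K, V)]; the inverse sends [h]
    to [z |-> (l |-> h (l z))]. *)
Lemma currying : exists Phi : {linear MKt L' K i' (MKt L L' j V) -> MKt L K i V},
  [/\ injective Phi, forall h, exists f, Phi f = h &
      forall f z, val (Phi f) z = val (val f z) (1 : L')].
Proof.
have lin1 (f : MKt L' K i' (MKt L L' j V)) a (y z : K) :
    val (val f (i a * y + z)) (1 : L') = a *: val (val f y) (1 : L') + val (val f z) (1 : L').
  rewrite -ij MKt_lin; rewrite -[LHS]/(val (val f y) ((1 : L') * j a) + val (val f z) (1 : L')).
  by rewrite mulrC MKt_mul.
have [phi phiE] := choice (fun f => MKt_ex (lin1 f)).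
have Lphi : linear phi.
  by move=> c f h; apply: MKt_ext => z; rewrite phiE /= !phiE.
have [Phi PhiE] := linear_bundle Lphi.
have PhiV f z : val (Phi f) z = val (val f z) (1 : L') by rewrite PhiE phiE.
have curry (f : MKt L' K i' (MKt L L' j V)) (z : K) (l : L') :
    val (val f z) l = val (val f (i' l * z)) (1 : L').
  by rewrite MKt_mul -[RHS]/(val (val f z) ((1 : L') * l)) mul1r.
exists Phi; split=> // [f h fh|h].
  apply: MKt_ext => z; apply: MKt_ext => l.
  by rewrite curry [RHS]curry -!PhiV fh.
have lin2 (z : K) (a : L) (l l' : L') : val h (i' (j a * l + l') * z) =
    a *: val h (i' l * z) + val h (i' l' * z).
  by rewrite rmorphD rmorphM ij mulrDl -mulrA MKt_lin.
have [G GE] := choice (fun z => MKt_ex (lin2 z)).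
have lin3 (a : L') (y z : K) : G (i' a * y + z) = a *: G y + G z.
  apply: MKt_ext => l.
  rewrite -[RHS]/(val (G y) ((l : L') * a) + val (G z) l) !GE.
  by rewrite -MKt_add mulrDr rmorphM mulrA.
have [f fE] := MKt_ex lin3.
exists f; apply: MKt_ext => z; rewrite PhiV fE GE rmorph1 mul1r //.
Qed.
End Transfer.

Section TransferDetects.
Variables (L L' K : fieldType) (i : {rmorphism L -> K}) (i' : {rmorphism L' -> K}).
Variable j : {rmorphism L -> L'}.
Hypothesis ij : forall z, i' (j z) = i z.
Variables (r s p : nat) (M : tmod L r).
Hypotheses (p1 : (1 < p)%N) (aM : tmod_ax p M).

(** Common pattern for changing the field and the variables together: [T] describes a subalgebra
    over [K] by natural operators, [t] its form over [L'], and currying matches the two. A flat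
    [alpha] into the subalgebra is flat into [R_K]. *)
Lemma detects_transfer (T : forall N : tmod K r, 'I_s -> {linear N -> N})
    (t : 'I_s -> {linear MK j M -> MK j M}) :
  (forall (N N' : tmod K r) (g : {linear N -> N'}), tmorph g ->
     forall l x, g (T N l x) = T N' l (g x)) ->
  (forall N, tmod_ax p N -> tmod_ax p (@TMod K s N (T N))) ->
  (forall N, tmod_ax p N -> exact p N -> exact p (@TMod K s N (T N))) ->
  (forall Phi : {linear MKt L' K i' (MK j M) -> MK i M},
     (forall f z, val (Phi f) z = val (val f z) (1 : L')) ->
     forall l f, Phi (MKop L' K i' (MK j M) (t l) f) = T (MK i M) l (Phi f)) ->
  detects i p M -> detects i' p (@TMod L' s (MK j M) t).
Proof.
move=> Tnat Tax Tex Tt dM u' u0' fl'.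
have aF := Free_ax r p K^o.
have eF := @Free_exact K r p K^o (ltnW p1).
have [u [u0 fl uE]] := substitution p1 Tnat (Tax _ aF) (Tex _ aF eF) u0' fl'.
have [Phi [Pinj Psurj PhiE]] := currying ij M.
have /exact1P e := dM u u0 fl.
pose M' := @TMod L' s (MK j M) t; pose N := @TMod K s (MK i M) (T (MK i M)).
have Pm : @tmorph K s (MK i' M') N Phi by move=> l f; exact: Tt.
have aMK := MK_ax i aM.
have Pact f : Phi (act (MK i' M') u' f) = act (MK i M) u (Phi f).
  by rewrite (uE _ aMK); exact: (tmorph_act u' f Pm).
apply/exact1P => f /= uf; have [|h fh] := e (Phi f); first by rewrite /= -Pact uf linear0.
have [h' h'E] := Psurj h; exists h'; apply: Pinj; rewrite fh /= -h'E.
by elim: (p.-1) => //= n ->; rewrite Pact.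
Qed.
End TransferDetects.

Section Descent.
Variables (p : nat) (K : fieldType).
Hypothesis p1 : (1 < p)%N.
Let p0 : (0 < p)%N := ltnW p1.

Lemma detects_MK (L L' : fieldType) (i : {rmorphism L -> K}) (i' : {rmorphism L' -> K})
    (j : {rmorphism L -> L'}) r (M : tmod L r) :
  (forall z, i' (j z) = i z) -> tmod_ax p M ->
  detects i p M -> detects i' p (MK j M).
Proof.
move=> ij aM.
apply: (@detects_transfer _ _ _ _ _ _ ij r r p M p1 aM (fun N => top N) (top (MK j M))).
- by move=> N N' g gm l x; exact: gm.
- by move=> N aN.
- by move=> N aN.
by move=> Phi PhiE l f; apply: MKt_ext => z; rewrite PhiE /= PhiE.
Qed.

Lemma detects_tail (L L' : fieldType) (i : {rmorphism L -> K}) (i' : {rmorphism L' -> K})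
    (j : {rmorphism L -> L'}) r (M : tmod L r.+1) : p \in [pchar K] ->
  (forall z, i' (j z) = i z) -> tmod_ax p M ->
  detects i p M -> detects i' p (MK j (tail M)).
Proof.
move=> pK ij aM.
apply: (@detects_transfer _ _ _ _ _ _ ij r.+1 r p M p1 aM (fun N => top (tail N))
  (top (MK j (tail M)))).
- by move=> N N' g gm l x; exact: gm.
- by move=> N aN; exact: tail_ax.
- by move=> N aN; exact: exact_tail.
by move=> Phi PhiE l f; apply: MKt_ext => z; rewrite PhiE /= PhiE.
Qed.

Lemma detects_hyp (L L' : fieldType) (i : {rmorphism L -> K}) (i' : {rmorphism L' -> K})
    (j : {rmorphism L -> L'}) r (M : tmod L r.+2) (x : L') : p \in [pchar K] ->
  (forall z, i' (j z) = i z) -> tmod_ax p M ->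
  detects i p M -> detects i' p (hyp x (MK j M)).
Proof.
move=> pK ij aM.
apply: (@detects_transfer _ _ _ _ _ _ ij r.+2 r.+1 p M p1 aM (fun N => top (hyp (i' x) N))
  (top (hyp x (MK j M)))).
- move=> N N' g gm l y; case: (unliftP ord0 l) => [l'|] ->; rewrite /= ?liftK ?unlift_none /=.
    exact: gm.
  by rewrite linearB linearZ /= !gm.
- by move=> N aN; exact: hyp_ax.
- by move=> N aN; exact: exact_hyp.
move=> Phi PhiE l f; apply: MKt_ext => z; rewrite PhiE.
case: (unliftP ord0 l) => [l'|] ->; rewrite /= ?liftK ?unlift_none /= ?PhiE //.
by congr (_ - _); rewrite (mulrC (z : K)) MKt_mul.
Qed.
End Descent.

(** * Induction on the rank *)

Section Dade.
Variables (p : nat) (K : fieldType).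
Hypothesis pK : p \in [pchar K].
Let p_prime := pcharf_prime pK.
Let p1 : (1 < p)%N := prime_gt1 p_prime.
Let p0 : (0 < p)%N := ltnW p1.

Lemma pchar_sub (L : fieldType) (i : {rmorphism L -> K}) : p \in [pchar L].
Proof. by rewrite -(fmorph_pchar i). Qed.

(** On the joint socle [N] of the variables after the first two, [core] writes [v] as
    [a^(p-1) b^(p-1) n] with [n] in [N]. Exactness for those variables makes [n] itself a value of
    their [sigma], so [v] is a value of the full one. *)
Lemma rank2_step (L L' : fieldType) (j : {rmorphism L -> L'}) (x : L') r (M : tmod L r.+2) :
  p \in [pchar L] -> is_closed L -> (forall c, j c != x) -> tmod_ax p M ->
  exact p (tail M) -> (forall lam, exact p (hyp lam M)) -> exact p (hyp x (MK j M)) ->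
  exact p M.
Proof.
move=> pL cl jx aM eb el ex; have [cM nM] := aM.
have aQ := tail_ax (tail_ax aM); set Q := tail (tail M) in aQ.
pose N (v : M) := forall i, top Q i v = 0.
pose a := top M ord0; pose b := top M (lift ord0 ord0).
have ab v : a (b v) = b (a v) by exact: cM.
have sN : subspace N.
  split=> [i|c u v Nu Nv i]; first by rewrite linear0.
  by rewrite linearP Nu Nv scaler0 addr0.
have Nstable (l : 'I_r.+2) v : N v -> N (top M l v).
  by move=> Nv i; rewrite /= cM [X in top M l X]Nv linear0.
have eNb : exact_on p N b.
  exact: (exact_on_tcons pL aQ (proj1 (exact_tcons p (tail M)) eb)).
have eNl lam : exact_on p N (fun v => a v - lam *: b v).
  exact: (exact_on_tcons pL aQ (el lam)).
have aQL := MK_ax j aQ.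
have eNx : exact_on p (fun g : MK j M => forall l, N (val g l))
    (fun g => MKop L L' j M a g - x *: MKop L L' j M b g).
  have pL' : p \in [pchar L'] by rewrite (fmorph_pchar j).
  have H := @exact_on_tcons L' p pL' r (tail (tail (MK j M))) _ aQL ex.
  move=> g Ng Tg; have [|h Nh gh] := H g _ Tg.
    by move=> i; apply: MKt_ext => l; exact: Ng.
  by exists h => // l i; have /(congr1 (fun f : MKt L L' j M => val f l)) := Nh i.
move=> v kv; have Nv : N v by move=> i; exact: kv.
have [n Nn ->] := core pL cl jx ab (nM _) (nM _) sN (Nstable _) (Nstable _)
  eNb eNl eNx Nv (kv _) (kv _).
have [|y ->] := exact_tail pL (tail_ax aM) eb (x := n); first exact: Nn.
by exists y; rewrite sig_tail (sig_tail p (N := tail M)).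
Qed.

Theorem detects_exact r (L : fieldType) (i : {rmorphism L -> K}) (M : tmod L r) :
  tower i r.-1 -> tmod_ax p M -> detects i p M -> exact p M.
Proof.
elim: r L i M => [|[|r] IH] L i M tw aM dM.
(* In rank zero [sigma] is an empty product, hence the identity. *)
- by move=> x _; exists x; rewrite /sig (_ : enum 'I_0 = [::]) //; apply: size0nil; rewrite size_enum_ord.
- have [u [u0 fl uE]] := variable_flat K p1.
  apply/(MK_exact i); have aMK := MK_ax i aM.
  have /exact1P e := dM u u0 fl.
  apply/exact1P => x tx; have [|y ->] := e x; first by rewrite /= uE.
  by exists y; elim: (p.-1) => //= n ->; rewrite uE.
have pL := pchar_sub i; have cl := tower_closed tw.
have tw1 := tower_pred tw.
have eb : exact p (tail M).
  (* The transfer lemmas speak of coinduced modules, so over the same field one coinduces along the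
     identity. *)
  apply/(MK_exact (idfun : {rmorphism L -> L})); apply: (IH L i) => //.
    exact/MK_ax/tail_ax.
  exact: detects_tail.
have el lam : exact p (hyp lam M).
  have e : exact p (hyp lam (MK (idfun : {rmorphism L -> L}) M)).
    apply: (IH L i) => //; last exact: detects_hyp.
    exact/(hyp_ax pL)/MK_ax.
  apply/(MK_exact (idfun : {rmorphism L -> L})).
  have H l y : top (MK (idfun : {rmorphism L -> L}) (hyp lam M)) l y =
      top (hyp lam (MK (idfun : {rmorphism L -> L}) M)) l y.
    apply: MKt_ext => z; case: (unliftP ord0 l) => [l'|] ->; rewrite /= ?liftK ?unlift_none //=.
    by congr (_ - _); rewrite -linearZ; congr (top M _ _); rewrite mulrC (MKt_mul y).
  exact: (proj2 (@eq_exact L r.+1 p (hyp lam (MK (idfun : {rmorphism L -> L}) M))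
    (top (MK (idfun : {rmorphism L -> L}) (hyp lam M))) H) e).
have [L' [i' [j [x [ij xj tw']]]]] := towerSP tw.
apply: (rank2_step pL cl xj aM eb el).
apply: (IH L' i') => //; last exact: detects_hyp.
exact/(hyp_ax (pchar_sub i'))/MK_ax.
Qed.
End Dade.

Theorem theorem4p3 (k : fieldType) (p r : nat) (K : closedFieldType)
    (iota : {rmorphism k -> K}) (M : tmod k r) :
  p \in [pchar k] ->
  trdeg_ge iota r.-1 ->
  tmod_ax p M ->
  (projective p M <->
   (forall u : RKel K r p,
      (forall m : mon r p, powRK K r p u p m = 0) ->
      flat_alpha u ->
      projective p (restrict (MK iota M) u))).
Proof.
move=> pk /trdeg_tower[L [i [j [ij tw]]]] aM.
have p1 := prime_gt1 (pcharf_prime pk); have p0 := ltnW p1.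
have pK : p \in [pchar K] by rewrite (fmorph_pchar iota).
have aMK := MK_ax iota aM.
rewrite (projectiveP p0 aM); split=> [eM u u0 fl|H].
  apply/(projectiveP p0); first exact: (restrict_ax p0 aMK u0).
  exact: (exact_flat p1 aMK (proj1 (MK_exact iota p M) eM) u0 fl).
(* [k] is first replaced by the algebraically closed field [L] at the bottom of the tower. *)
apply/(MK_exact j)/(detects_exact pK tw); first exact: MK_ax.
apply: (detects_MK p1 ij aM) => u u0 fl.
by apply/(projectiveP p0); [exact: (restrict_ax p0 aMK u0) | exact: H].
Qed.
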